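(* Let $k\ge 1$ and $r\ge 1$. (1) If $\mathfrak{g}_k=\mathfrak{p}^A\frac{k|2|\cdots|2}{k+1|2|\cdots|2|1}$, with $r$ parts equal to $2$ on top and $r-1$ parts equal to $2$ followed by a part $1$ on the bottom, then $\mathfrak{g}_k$ has the unimodal spectrum property and its spectrum is $$\{0^{k+2r-1},1^{k+2r-1}\}\cup\bigcup_{i=1}^{k-1}\{(-k+i)^i,(k-i+1)^i\}.$$ (2) If $\mathfrak{g}_k=\mathfrak{p}^A\frac{k|2|\cdots|2|1}{k+1|2|\cdots|2}$, with $r$ parts equal to $2$ followed by a part $1$ on top and $r$ parts equal to $2$ on the bottom, then $\mathfrak{g}_k$ has the unimodal spectrum property and its spectrum is $$\{0^{k+2r},1^{k+2r}\}\cup\bigcup_{i=1}^{k-1}\{(-k+i)^i,(k-i+1)^i\}.$$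
   Context: Type-A seaweeds: for compositions $\underline a=(a_1,\dots,a_m)$ and $\underline b=(b_1,\dots,b_t)$ of $n$, let $e_1,\dots,e_n$ be a basis of $V=\mathbb{C}^n$, $V_i=\mathrm{span}\{e_1,\dots,e_{a_1+\dots+a_i}\}$ and $W_j=\mathrm{span}\{e_{b_1+\dots+b_j+1},\dots,e_n\}$. The type-A seaweed $\mathfrak{p}^A\frac{a_1|\cdots|a_m}{b_1|\cdots|b_t}$ is the subalgebra of $\mathfrak{sl}(n)$ of matrices preserving both flags $0\subset V_1\subset\dots\subset V_m=V$ and $V=W_0\supset W_1\supset\dots\supset W_t=0$. These algebras are Frobenius: there is $F\in\mathfrak{g}^*$ with $(x,y)\mapsto F([x,y])$ nondegenerate; the unique $\widehat F\in\mathfrak{g}$ with $F([\widehat F,x])=F(x)$ for all $x$ defines the spectrum of $\mathfrak{g}$ as the multiset of eigenvalues of $\mathrm{ad}\,\widehat F$ on $\mathfrak{g}$. A Frobenius type-A seaweed has the unimodal spectrum property if, listing its distinct eigenvalues in increasing order, the corresponding sequence of multiplicities $c_0,\dots,c_N$ is unimodal, i.e. $c_0\le\dots\le c_j\ge\dots\ge c_N$ for some $j$. Notation: $\{x^k\}$ denotes $x$ with multiplicity $k$, and $\cup$ denotes multiset union (multiplicities add). *)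

(* Defs.v *)
(* The field of complex numbers is R[i], for R : realType. *)
From mathcomp Require Export all_boot all_order all_algebra reals complex.

Set Implicit Arguments.
Unset Strict Implicit.
Unset Printing Implicit Defensive.

Import Order.TTheory GRing.Theory Num.Theory.
Local Open Scope ring_scope.

Section Frobenius.
Variables (K : fieldType) (L : vectType K) (br : L -> L -> L).

Definition nondegenerate_functional (F : 'Hom(L, K^o)) : Prop :=
  forall x, (forall y, F (br x y) = 0) -> x = 0.

Definition frobenius : Prop :=
  exists F : 'Hom(L, K^o), nondegenerate_functional F.

Definition principal_element (F : 'Hom(L, K^o)) (Fh : L) : Prop :=
  forall x, F (br Fh x) = F x.

(* [linfun (br x)] is [br x] as soon as [br] is linear on the right. *)
Definition ad (x : L) : 'End(L) := linfun (br x).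

(* The eigenvalues of [f], with algebraic multiplicities, are the elements of
   [s]; this determines [s] up to permutation. *)
Definition eigenvalue_multiset (f : 'End(L)) (s : seq K) : Prop :=
  char_poly (passmx.mxof (vbasis {:L}) (vbasis {:L}) f)
    = \prod_(a <- s) ('X - a%:P).

(* [L] is Frobenius with spectrum [s]. The functional is quantified
   universally, so that the spectrum does not depend on its choice. *)
Definition spectrum (s : seq K) : Prop :=
  frobenius /\
  forall F : 'Hom(L, K^o), nondegenerate_functional F ->
    exists2 Fh : L, unique (principal_element F) Fh
                  & eigenvalue_multiset (ad Fh) s.

End Frobenius.

Definition unimodal (c : seq nat) : Prop :=
  exists j : nat, sorted leq (take j.+1 c) /\ sorted geq (drop j c).

Section Unimodal.
Variables (K : numFieldType) (L : vectType K) (br : L -> L -> L).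

(* On real numbers the partial order of [K] is total, so that [sort] does list
   the distinct eigenvalues in increasing order. *)
Definition multiplicities (s : seq K) : seq nat :=
  [seq count_mem x s | x <- sort <=%R (undup s)].

Definition unimodal_spectrum : Prop :=
  exists s : seq K, [/\ spectrum br s, {subset s <= Num.real}
                      & unimodal (multiplicities s)].

End Unimodal.

Section Seaweed.
Variables (K : fieldType) (n : nat).

(* Matrices act on the left on column vectors; the basis vector [e_(j+1)] is
   [delta_mx j 0]. *)
Definition flagV (a : seq nat) (i : nat) : {vspace 'cV[K]_n} :=
  (\sum_(j < n | (j < sumn (take i a))%N) <[delta_mx j 0%R]>)%VS.

Definition flagW (b : seq nat) (i : nat) : {vspace 'cV[K]_n} :=
  (\sum_(j < n | (sumn (take i b) <= j)%N) <[delta_mx j 0%R]>)%VS.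

Definition stabilizer (U : {vspace 'cV[K]_n}) : {vspace 'M[K]_n} :=
  (\bigcap_(l < \dim U) (linfun (mulmxr (vbasis U)`_l) @^-1: U))%VS.

Definition sl : {vspace 'M[K]_n} :=
  lker (linfun (mxtrace : 'M[K]_n -> K^o)).

(* Meant for compositions [a] and [b] of [n]. *)
Definition seaweed (a b : seq nat) : {vspace 'M[K]_n} :=
  (sl :&: \bigcap_(i < (size a).+1) stabilizer (flagV a i)
      :&: \bigcap_(j < (size b).+1) stabilizer (flagW b j))%VS.

Lemma memv_bigcap m (U : 'I_m -> {vspace 'M[K]_n}) x :
  (x \in (\bigcap_(i < m) U i)%VS) <-> (forall i, x \in U i).
Proof.
rewrite memvE; split=> [/subv_bigcapP H i|H]; first by rewrite memvE H.
by apply/subv_bigcapP => i _; rewrite -memvE.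
Qed.

Lemma mem_stabilizer U (x : 'M[K]_n) :
  (x \in stabilizer U) <-> (forall v, v \in U -> x *m v \in U).
Proof.
split=> [/memv_bigcap H v Uv | H]; last first.
  apply/memv_bigcap => i; rewrite -memv_preim lfunE /=; apply: H.
  by rewrite vbasis_mem // mem_nth // size_tuple.
rewrite (coord_vbasis Uv) mulmx_sumr rpred_sum // => i _.
rewrite -scalemxAr rpredZ //.
by have := H i; rewrite -memv_preim lfunE.
Qed.

Lemma mem_seaweed a b (x : 'M[K]_n) :
  (x \in seaweed a b) <->
  [/\ \tr x = 0,
      forall i v, (i <= size a)%N ->
        v \in flagV a i -> x *m v \in flagV a i
    & forall j v, (j <= size b)%N ->
        v \in flagW b j -> x *m v \in flagW b j].
Proof.
rewrite !memv_cap memv_ker lfunE /=; split.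
  case/andP=> /andP[/eqP tr0 /memv_bigcap Ha] /memv_bigcap Hb.
  split=> // i v le_i.
    by have /mem_stabilizer := Ha (inord i); rewrite inordK //; apply.
  by have /mem_stabilizer := Hb (inord i); rewrite inordK //; apply.
case=> tr0 Ha Hb; rewrite tr0 eqxx /=; apply/andP; split.
  apply/memv_bigcap => i; apply/mem_stabilizer => v.
  by apply: Ha; rewrite -ltnS.
apply/memv_bigcap => i; apply/mem_stabilizer => v.
by apply: Hb; rewrite -ltnS.
Qed.

Lemma seaweed_closed a b (x y : 'M[K]_n) :
  x \in seaweed a b -> y \in seaweed a b ->
  x *m y - y *m x \in seaweed a b.
Proof.
move=> /mem_seaweed[_ xa xb] /mem_seaweed[_ ya yb]; apply/mem_seaweed; split.
- by rewrite linearB /= mxtrace_mulC subrr.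
- move=> i v le_i Uv; rewrite mulmxBl -!mulmxA rpredB //.
  + by apply: xa => //; apply: ya.
  + by apply: ya => //; apply: xa.
- move=> i v le_i Uv; rewrite mulmxBl -!mulmxA rpredB //.
  + by apply: xb => //; apply: yb.
  + by apply: yb => //; apply: xb.
Qed.

Definition seaweed_bracket a b (x y : subvs_of (seaweed a b)) :
    subvs_of (seaweed a b) :=
  Subvs (seaweed_closed (subvsP x) (subvsP y)).

End Seaweed.

(* Main.v *)
(* Both seaweeds are the trace-zero part of
   the incidence algebra of a preorder on n = k + m points: a full gl_k, one
   column K^k at index k, and a path on the last m indices.  Extending a
   functional to F(y) = tr(f y), let A, phi be the gl_k- and column-parts of f.
   Then F is nondegenerate iff (A, phi) is cyclic and F is nonzero on each edge of
   the path: if v, psi are right and left eigenvectors of A for the same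
   eigenvalue with phi v = 0, then v psi lies in the radical, and conversely
   [A, X] = u phi forces phi A^i u = tr(A^i [A, X]) = 0.
   For a principal element with components X, u, T the equations read
   [A, X] - u phi = A, phi X = (c + 1) phi and T_oo = T_ee + 1 on edges, so X is
   triangular on phi, phi A, phi A^2, ... with eigenvalues c + 1, ..., c + k, and
   the element is conjugate inside the algebra to an explicit diagonal matrix
   diag(d).  Its adjoint action is then diagonal with eigenvalues d_p - d_q. *)

From HB Require Import structures.
Require Import Defs.
From mathcomp Require Import zify ring.

Set Implicit Arguments.
Unset Strict Implicit.
Unset Printing Implicit Defensive.

Import Order.TTheory GRing.Theory Num.Theory passmx.
Local Open Scope ring_scope.

(** * Linear algebra: characteristic polynomials, dual bases, independence of eigenvectors *)

(** The two sides are compared after multiplication by [\det P], a nonzero constant polynomial,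
    which can be cancelled. *)
Lemma char_poly_intertwine (K : fieldType) n (P A B : 'M[K]_n) :
  P \in unitmx -> P *m A = B *m P -> char_poly A = char_poly B.
Proof.
move=> uP eqPA; pose P' := map_mx polyC P.
have nzP : \det P' != 0.
  by rewrite /P' det_map_mx polyC_eq0 -unitfE -unitmxE.
apply: (mulfI nzP); rewrite /char_poly -det_mulmx mulrC -det_mulmx.
congr (\det _); rewrite /char_poly_mx mulmxBr mulmxBl -!map_mxM -eqPA.
by rewrite scalar_mxC.
Qed.

Lemma char_poly_diag (K : comNzRingType) n (d : 'rV[K]_n) :
  char_poly (diag_mx d) = \prod_i ('X - (d 0 i)%:P).
Proof.
rewrite char_poly_trig ?diag_mx_is_trig //.
by apply: eq_bigr => i _; rewrite mxE eqxx.
Qed.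

(** The coordinates of the eigenvectors form a matrix [P] intertwining the matrix of [f] with a
    diagonal one. The index type is arbitrary because the family used later is indexed by pairs of
    matrix positions. *)
Lemma char_poly_mxof_eigenbasis (K : fieldType) (L : vectType K)
    (f : 'End(L)) (I : eqType) (s : seq I) (w : I -> L) (lam : I -> K) :
  basis_of {:L} [seq w i | i <- s] ->
  {in s, forall i, f (w i) = lam i *: w i} ->
  char_poly (mxof (vbasis {:L}) (vbasis {:L}) f)
    = \prod_(i <- s) ('X - (lam i)%:P).
Proof.
move=> bas eig; set e := vbasis {:L}.
have be : basis_of {:L} e by exact: vbasisP.
have szs : size s = \dim {:L}.
  by rewrite -(size_map w) -(size_basis (X := in_tuple _) bas).
(* In dimension zero [s] is empty and offers no default index [i0] for [nth]. *)
case: (posnP (\dim {:L})) => [d0|dpos].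
  have s0 : s = [::] by apply/nilP; rewrite /nilp szs d0.
  rewrite s0 big_nil /char_poly; move: (char_poly_mx _); rewrite d0 => M.
  by rewrite det_mx00.
have /hasP[i0 _ _] : has predT s by rewrite has_predT szs.
have szw : size [seq w i | i <- s] == \dim {:L} by rewrite size_map szs.
pose b := Tuple szw.
have nthb (j : 'I_(\dim {:L})) : b`_j = w (nth i0 s j).
  by rewrite (nth_map i0) ?szs.
pose P := \matrix_(j < \dim {:L}) rVof e b`_j.
pose P' := \matrix_(j < \dim {:L}) rVof b e`_j.
have uP : P \in unitmx.
  suff: P' *m P = 1%:M by case/mulmx1_unit.
  apply/row_matrixP => i; rewrite row_mul rowK row1 -(rVofE be).
  rewrite mulmx_sum_row [e`_i in RHS](coord_basis (X := b) bas (memvf _)).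
  rewrite linear_sum /=.
  by apply: eq_bigr => j _; rewrite linearZ /= rowK mxE.
pose d := \row_(j < \dim {:L}) lam (nth i0 s j).
rewrite (@char_poly_intertwine _ _ P _ (diag_mx d)) //; last first.
  apply/row_matrixP => j; rewrite row_mul rowK -(rVof_app _ be).
  rewrite nthb eig ?mem_nth ?szs // linearZ /=.
  by apply/rowP => l; rewrite mul_diag_mx !mxE nthb.
rewrite char_poly_diag (big_nth i0) szs big_mkord.
by apply: eq_bigr => j _; rewrite mxE.
Qed.

(** Duality gives freeness. For generation, [y] minus [\sum_i h i y *: w i] is killed by every
    [h i], so separation makes it vanish. *)
Lemma basis_of_dual (K : fieldType) (L : vectType K) (I : eqType) (s : seq I)
    (w : I -> L) (h : I -> 'Hom(L, K^o)) :
  uniq s -> {in s &, forall i j, h i (w j) = (i == j)%:R} ->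
  (forall y, {in s, forall i, h i y = 0} -> y = 0) ->
  basis_of {:L} [seq w i | i <- s].
Proof.
move=> us hw sep; apply/andP; split.
  rewrite eqEsubv subvf /=; apply/subvP => y _.
  have -> : y = \sum_(i <- s) h i y *: w i.
    apply/eqP; rewrite -subr_eq0; apply/eqP/sep => i si.
    rewrite linearB linear_sum /= (big_rem i) //= linearZ /= hw // eqxx.
    rewrite [_ *: _]mulr1.
    rewrite big_seq big1 ?addr0 => [|j]; first by rewrite subrr.
    rewrite mem_rem_uniq // !inE => /andP[ji sj].
    by rewrite linearZ /= hw // eq_sym (negPf ji) scaler0.
  rewrite big_seq; apply: rpred_sum => i si; apply: rpredZ.
  by apply: memv_span; apply: map_f.
elim: s us hw {sep} => [|i s IH] /= => [_ _|/andP[nis us] hw].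
  exact: nil_free.
rewrite free_cons; apply/andP; split; last first.
  by apply: IH => // j l js ls; apply: hw; rewrite inE ?js ?ls orbT.
apply: contraNN (oner_neq0 K) => wis.
have /subvP/(_ _ wis) : (span [seq w j | j <- s] <= lker (h i))%VS.
  apply/span_subvP => _ /mapP[j js ->]; rewrite memv_ker hw ?inE ?eqxx //.
    by rewrite (_ : (i == j) = false) //; apply: contraNF nis => /eqP->.
  by rewrite js orbT.
by rewrite memv_ker hw ?inE ?eqxx.
Qed.

Lemma mxtrace_mul_delta (K : comNzRingType) n (M : 'M[K]_n) i j :
  \tr (M *m delta_mx i j) = M j i.
Proof.
rewrite /mxtrace (bigD1 j) //= big1 ?addr0 => [|l lj]; rewrite !mxE.
  rewrite (bigD1 i) //= big1 ?addr0 ?mxE ?eqxx ?mulr1 // => l li.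
  by rewrite mxE (negPf li) mulr0.
by apply: big1 => q _; rewrite mxE (negPf lj) andbF mulr0.
Qed.

Lemma mxtrace_nondeg (K : comNzRingType) n (M : 'M[K]_n) :
  (forall Y, \tr (M *m Y) = 0) -> M = 0.
Proof. by move=> H; apply/matrixP => i j; rewrite -mxtrace_mul_delta H mxE. Qed.

(** Eigenvectors for distinct eigenvalues are independent: on a relation [a] between the rows, the
    polynomial [p], which vanishes at every eigenvalue but the [i]-th, isolates the coefficient
    [a 0 i]. *)
Lemma eigenrows_unitmx (K : fieldType) n (Z X : 'M[K]_n.+1) (d : 'rV[K]_n.+1) :
  injective (d 0) -> (forall i, row i Z != 0) -> Z *m X = diag_mx d *m Z ->
  Z \in unitmx.
Proof.
move=> injd nz eqZ; rewrite -row_free_unit -kermx_eq0; apply/rowV0P => a.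
move=> /sub_kermxP aZ; apply/rowP => i; rewrite mxE; apply/eqP.
pose p := \prod_(j | j != i) ('X - (d 0 j)%:P).
have comm (q : {poly K}) : Z *m horner_mx X q = horner_mx (diag_mx d) q *m Z.
  elim/poly_ind: q => [|q c IH]; first by rewrite !rmorph0 mulmx0 mul0mx.
  rewrite !rmorphD !rmorphM /= !horner_mx_X !horner_mx_C.
  rewrite mulmxDr mulmxDl -scalar_mxC; congr (_ + _).
  by rewrite -!mulmxE mulmxA IH -!mulmxA eqZ.
have := congr1 (mulmx a) (comm p); rewrite mulmxA aZ mul0mx.
rewrite horner_mx_diag mulmxA => /esym/eqP.
rewrite [a *m _]mulmx_sum_row.
have -> : \sum_j a 0 j *: row j (diag_mx (map_mx (horner p) d))
          = (a 0 i * p.[d 0 i]) *: delta_mx 0 i.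
  rewrite (bigD1 i) //= big1 ?addr0 => [|j ji].
    by rewrite row_diag_mx mxE scalerA.
  rewrite row_diag_mx mxE /p horner_prod (bigD1 j) //=.
  by rewrite !hornerE subrr mul0r scale0r scaler0.
rewrite -scalemxAl -rowE scaler_eq0 (negPf (nz i)) orbF mulf_eq0.
case/orP=> //; rewrite horner_prod => /eqP p0; move: (oner_neq0 K).
suff: \prod_(j | j != i) ('X - (d 0 j)%:P).[d 0 i] != 0 by rewrite p0 eqxx.
apply/prodf_neq0 => j ji; rewrite !hornerE subr_eq0.
by apply: contraNneq ji => /injd->.
Qed.

(** * Matrix units and the path part of the algebra *)

Lemma mxBE (K : zmodType) m n (A B : 'M[K]_(m, n)) i j :
  (A - B) i j = A i j - B i j.
Proof. by rewrite !mxE. Qed.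

Lemma mulmx_deltaE (K : pzSemiRingType) m n p (T : 'M[K]_(m, n))
    (i : 'I_n) (j : 'I_p) a b :
  (T *m delta_mx i j) a b = T a i * (b == j)%:R.
Proof.
rewrite mxE (bigD1 i) //= big1 ?addr0 => [|l li]; rewrite mxE ?eqxx //=.
by rewrite (negPf li) mulr0.
Qed.

Lemma delta_mulmxE (K : pzSemiRingType) m n p (T : 'M[K]_(n, p))
    (i : 'I_m) (j : 'I_n) a b :
  (delta_mx i j *m T) a b = (a == i)%:R * T j b.
Proof.
rewrite mxE (bigD1 j) //= big1 ?addr0 => [|l lj]; rewrite mxE ?eqxx ?andbT //=.
by rewrite (negPf lj) andbF mul0r.
Qed.

Lemma mx0E (K : nmodType) m n i j : (0 : 'M[K]_(m, n)) i j = 0.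
Proof. by rewrite mxE. Qed.

(* [path_rel i j] says that the entry [(i, j)] is allowed in the part of the
   seaweed made of blocks of size 2: diagonal entries, and the edges of a path,
   oriented from even (column) to odd (row) vertices. *)
Definition path_rel (i j : nat) : bool :=
  (i == j) || ~~ odd j && ((i == j.+1) || (j == i.+1)).

Lemma path_rel_oddr i j : odd j -> path_rel i j = (i == j).
Proof. by rewrite /path_rel => ->; rewrite orbF. Qed.

Lemma path_rel_evenl i j : ~~ odd i -> path_rel i j = (i == j).
Proof. by rewrite /path_rel; lia. Qed.

Lemma path_edge m (o e : 'I_m) : path_rel o e -> o != e -> odd o /\ ~~ odd e.
Proof. by rewrite /path_rel -val_eqE /=; lia. Qed.

Definition path_mx (K : nzRingType) m (T : 'M[K]_m) : Prop :=
  forall i j : 'I_m, ~~ path_rel i j -> T i j = 0.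

Section PathMatrix.
Variables (K : comNzRingType) (m : nat).
Implicit Types (T : 'M[K]_m) (o e i j : 'I_m).

Lemma path_mxD T T' : path_mx T -> path_mx T' -> path_mx (T + T').
Proof. by move=> pT pT' i j nij; rewrite mxE pT ?pT' ?addr0. Qed.

Lemma path_mxN T : path_mx T -> path_mx (- T).
Proof. by move=> pT i j nij; rewrite mxE pT ?oppr0. Qed.

Lemma path_mx0 : path_mx (0 : 'M[K]_m).
Proof. by move=> i j _; rewrite mxE. Qed.

Lemma path_mx_delta i j : path_rel i j -> path_mx (delta_mx i j : 'M[K]_m).
Proof.
move=> rij a b; rewrite mxE; case: eqP => //= ->; case: eqP => //= ->.
by rewrite rij.
Qed.

Lemma path_mx_diag (d : 'rV[K]_m) : path_mx (diag_mx d).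
Proof.
by move=> i j; rewrite mxE /path_rel -val_eqE /=; case: eqP.
Qed.

Lemma path_mx_even T i j : path_mx T -> ~~ odd i -> i != j -> T i j = 0.
Proof. by move=> pT ei ij; apply: pT; rewrite path_rel_evenl. Qed.

Lemma path_mx_odd T i j : path_mx T -> odd j -> i != j -> T i j = 0.
Proof. by move=> pT oj ij; apply: pT; rewrite path_rel_oddr. Qed.

(** Since [o] is odd and [e] is even, column [o] and row [e] of [T] vanish off the diagonal. *)
Lemma path_mx_comm_delta T o e : path_mx T -> path_rel o e -> o != e ->
  T *m delta_mx o e - delta_mx o e *m T = (T o o - T e e) *: delta_mx o e.
Proof.
move=> pT roe noe; have [oo ee] := path_edge roe noe.
apply/matrixP => a b; rewrite mxBE mulmx_deltaE delta_mulmxE !mxE.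
have [->|ao] := eqVneq a o; last first.
  by rewrite (path_mx_odd pT oo ao) !mul0r mulr0 subrr.
have [->|] := eqVneq b e; first by rewrite !mul1r !mulr1.
rewrite eq_sym => eb.
by rewrite (path_mx_even pT ee eb) !(mulr0, mul0r) subrr.
Qed.

(* The vertices lying beyond the edge joining [o] and [e]; bracketing with
   their sum of diagonal units isolates that edge. *)
Definition cut_mx o e : 'M[K]_m := diag_mx (\row_j (minn o e < j)%:R).

(** Every other edge has both ends on the same side of the cut, so its entry cancels. The sign tells
    which end of the edge lies beyond the cut. *)
Lemma path_mx_comm_cut T o e : path_mx T -> path_rel o e -> o != e ->
  T *m cut_mx o e - cut_mx o e *m T = (-1) ^+ (e < o)%N *: (T o e *: delta_mx o e).
Proof.
move=> pT roe noe; have [oo ee] := path_edge roe noe.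
apply/matrixP => a b; rewrite /cut_mx mul_mx_diag mul_diag_mx !mxE.
have [rab|/pT Tab0] := boolP (path_rel a b); last first.
  rewrite Tab0; case: eqVneq => [ao|_] /=; last by rewrite !(mulr0, mul0r) subrr.
  case: eqVneq => [be|_] /=; last by rewrite !(mulr0, mul0r) subrr.
  by rewrite -ao -be Tab0 !(mulr0, mul0r) subrr.
have [->|nab] := eqVneq a b.
  have -> : (b == o) && (b == e) = false.
    by apply: contraNF noe => /andP[/eqP<- /eqP<-].
  by rewrite /= !mulr0 mulrC subrr.
have [oa eb] := path_edge rab nab.
have [/andP[/eqP-> /eqP->]|] := boolP ((a == o) && (b == e)).
  rewrite mulr1 minnC; case: (ltngtP e o) => eo /=; rewrite ?ltnn ?eo.
  - by rewrite expr1 mulr0 mul1r sub0r mulN1r.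
  - by rewrite expr0 mulr1 mul0r subr0 mul1r.
  - by move: noe; rewrite -val_eqE /= eo eqxx.
rewrite !mulr0 => nabe.
suff -> : (minn o e < b)%N = (minn o e < a)%N by rewrite mulrC subrr.
by move: roe rab noe nabe; rewrite /path_rel -!val_eqE /=; lia.
Qed.

(** The path is connected: consecutive indices always form an edge, and the parity of [l] decides
    which of [l] and [l.+1] is its odd end. *)
Lemma path_diag_const (d : 'I_m -> K) :
  (forall o e, path_rel o e -> o != e -> d o = d e) ->
  forall i j, d i = d j.
Proof.
move=> dE i j; suff H i' : d i' = d (Ordinal (leq_ltn_trans (leq0n i) (ltn_ord i))).
  by rewrite [LHS]H [RHS]H.
case: i' => l; elim: l => [|l IH] lm; first by congr d; apply: val_inj.
have lm' := ltnW lm; rewrite -(IH lm').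
case ol: (odd l).
  symmetry; apply: dE; rewrite -?val_eqE /path_rel /= ?ol ?eqxx ?orbT //.
  by rewrite neq_ltn ltnSn.
by apply: dE; rewrite -?val_eqE /path_rel /= ?ol ?eqxx ?orbT // neq_ltn ltnSn orbT.
Qed.

End PathMatrix.

Lemma path_mx_row0 (K : comNzRingType) m (T : 'M[K]_m.+1) : path_mx T ->
  delta_mx 0 0 *m T = T 0 0 *: delta_mx 0 0 :> 'rV_m.+1.
Proof.
move=> pT; apply/rowP => j; rewrite delta_mulmxE !mxE !eqxx mul1r /=.
have [->|j0] := eqVneq j 0; first by rewrite mulr1.
by rewrite (path_mx_even pT) 1?eq_sym ?mulr0.
Qed.

(** * The coadjoint equations in block form *)

Section Form.
Variables (K : fieldType) (k m : nat).
Implicit Types (X Y : 'M[K]_k) (u w : 'cV[K]_k) (T : 'M[K]_m.+1).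
Implicit Types (f : 'M[K]_(k + m.+1)).

(* A seaweed element before the trace is normalized: a full block [X], a column
   [u] at index [k], and a path matrix [T] on the remaining indices. *)
Definition block_elt X u T : 'M[K]_(k + m.+1) :=
  block_mx X (u *m delta_mx 0 0) 0 T.

(** The column meets only row 0 of the path matrices. As 0 is even, that row is diagonal, so only
    the scalars [T 0 0] and [T' 0 0] enter. *)
Lemma block_elt_comm X u T Y w T' : path_mx T -> path_mx T' ->
  block_elt X u T *m block_elt Y w T' - block_elt Y w T' *m block_elt X u T
  = block_elt (X *m Y - Y *m X)
      ((X *m w - T 0 0 *: w) - (Y *m u - T' 0 0 *: u)) (T *m T' - T' *m T).
Proof.
move=> pT pT'; rewrite /block_elt !mulmx_block !mulmx0 !mul0mx !addr0 !add0r.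
rewrite opp_block_mx add_block_mx oppr0 addr0; congr block_mx.
rewrite -(mulmxA u) -(mulmxA w) !path_mx_row0 // -!scalemxAr.
rewrite !mulmxBl -!scalemxAl !mulmxA.
rewrite opprD opprB !addrA [LHS]addrAC; congr (_ + _).
exact: addrAC.
Qed.

Lemma mxtrace_block_elt f Y w T' :
  \tr (f *m block_elt Y w T') = \tr (ulsubmx f *m Y)
    + (row 0 (dlsubmx f) *m w) 0 0 + \tr (drsubmx f *m T').
Proof.
rewrite -{1}[f]submxK /block_elt mulmx_block !mulmx0 !addr0 mxtrace_block.
rewrite mxtraceD -addrA; congr (_ + (_ + _)).
rewrite mulmxA mxtrace_mulC mulmxA -rowE trace_mx11 //.
Qed.

(** For the functional [F y = \tr (f *m y)], the value [mu = 0] gives the equation of the radical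
    and [mu = 1] that of a principal element; both are solved together. *)
Definition coadjoint_scaled f x (mu : K) := forall Y w T', path_mx T' ->
  \tr (f *m (x *m block_elt Y w T' - block_elt Y w T' *m x))
  = mu * \tr (f *m block_elt Y w T').

Variables (f : 'M[K]_(k + m.+1)) (X : 'M[K]_k) (u : 'cV[K]_k).
Variables (T : 'M[K]_m.+1) (mu : K).
Hypothesis pT : path_mx T.
Hypothesis Hx : coadjoint_scaled f (block_elt X u T) mu.

Let A := ulsubmx f.
Let phi := row 0 (dlsubmx f).
Let Psi := drsubmx f.

Let HxE Y w T' : path_mx T' ->
  \tr (A *m (X *m Y - Y *m X))
   + (phi *m (X *m w - T 0 0 *: w - (Y *m u - T' 0 0 *: u))) 0 0
   + \tr (Psi *m (T *m T' - T' *m T))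
  = mu * (\tr (A *m Y) + (phi *m w) 0 0 + \tr (Psi *m T')).
Proof.
by move=> pT'; have := Hx Y w pT'; rewrite block_elt_comm // !mxtrace_block_elt.
Qed.

(** Test elements with a single nonzero component split the coadjoint equation into three. Here [Y]
    varies, and the trace form on the full matrix block is nondegenerate. *)
Lemma comm_block_gl : A *m X - X *m A - u *m phi = mu *: A.
Proof.
apply/eqP; rewrite -subr_eq0; apply/eqP/mxtrace_nondeg => Y.
have := HxE Y 0 (@path_mx0 _ _).
rewrite !(mulmx0, mul0mx, mx0E, mxtrace0, scaler0, scale0r, oppr0, addr0, add0r, subr0).
rewrite mulmxN => H.
rewrite mulmxBl linearB /= -scalemxAl linearZ /= -H.
rewrite mulmxBl linearB /= mulmxBl linearB /= mulmxBr linearB /=.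
have -> : (- (phi *m (Y *m u))) 0 0 = - \tr (u *m phi *m Y).
  rewrite (_ : \tr (u *m phi *m Y) = \tr (phi *m (Y *m u))).
    by rewrite trace_mx11 mxE.
  by rewrite -mulmxA mxtrace_mulC mulmxA.
rewrite (mulmxA A Y X) (mulmxA A X Y).
have -> : \tr (X *m A *m Y) = \tr (A *m Y *m X).
  by rewrite -mulmxA mxtrace_mulC.
by rewrite addrC addNr.
Qed.

Lemma comm_block_col : phi *m X = (T 0 0 + mu) *: phi.
Proof.
apply/eqP; rewrite -subr_eq0; apply/eqP/rowP => j; rewrite [RHS]mxE.
have := HxE 0 (delta_mx j 0) (@path_mx0 _ _).
rewrite !(mulmx0, mul0mx, mx0E, mxtrace0, oppr0, addr0, add0r, scale0r, subr0).
rewrite mulmxBr mulmxA -scalemxAr -!colE mxBE => /eqP; rewrite -subr_eq0 => /eqP H.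
by rewrite -{}H !mxE; ring.
Qed.

Lemma comm_block_path T' : path_mx T' -> 
  T' 0 0 * (phi *m u) 0 0 + \tr (Psi *m (T *m T' - T' *m T))
  = mu * \tr (Psi *m T').
Proof.
move=> pT'; have := HxE 0 0 pT'.
rewrite !(mulmx0, mul0mx, mx0E, mxtrace0, oppr0, addr0, add0r, scaler0, sub0r, opprK).
by rewrite -scalemxAr mxE.
Qed.

Lemma comm_block_edge (o e : 'I_m.+1) : path_rel o e -> o != e ->
  Psi e o * (T o o - T e e) = mu * Psi e o.
Proof.
move=> roe noe; have [oo ee] := path_edge roe noe.
have := comm_block_path (path_mx_delta K roe).
rewrite path_mx_comm_delta // -scalemxAr linearZ /= !mxtrace_mul_delta mxE.
(* The column term carries the [(0, 0)] entry of the test matrix, which is zero because [o] is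
   odd. *)
have -> : (0 == o) = false by apply: contraTF oo => /eqP<-.
by rewrite /= mul0r add0r mulrC.
Qed.

End Form.

(** * Krylov matrices and cyclic row vectors *)

Section Cyclic.
Variables (K : fieldType) (k : nat).
Implicit Types (A X : 'M[K]_k.+1) (phi : 'rV[K]_k.+1) (u v : 'cV[K]_k.+1).

(** Its invertibility expresses that [phi] is a cyclic vector for [A] acting on rows. *)
Definition krylov_mx A phi : 'M[K]_k.+1 := \matrix_(i < k.+1) (phi *m A ^+ i).

Lemma horner_mx_sum A (p : {poly K}) :
  horner_mx A p = \sum_(i < size p) p`_i *: A ^+ i.
Proof.
rewrite -{1}[p]coefK poly_def rmorph_sum /=; apply: eq_bigr => i _.
by rewrite linearZ /= rmorphXn /= horner_mx_X.
Qed.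

(* By Cayley-Hamilton, the first powers of [A] suffice. *)
Lemma krylov_mx_kernel A phi v :
  krylov_mx A phi *m v = 0 -> forall i, phi *m A ^+ i *m v = 0.
Proof.
move=> Cv i.
have small (j : 'I_k.+1) : phi *m A ^+ j *m v = 0.
  by rewrite -(rowK (fun j : 'I_k.+1 => phi *m A ^+ j)) -row_mul Cv row0.
have -> : A ^+ i = horner_mx A ('X^i %% char_poly A).
  rewrite -{1}[A]horner_mx_X -rmorphXn /= {1}(divp_eq 'X^i (char_poly A)).
  by rewrite rmorphD rmorphM /= Cayley_Hamilton mulr0 add0r.
rewrite horner_mx_sum mulmx_sumr mulmx_suml big1 // => j _.
have jk : (j < k.+1)%N.
  have := ltn_modp 'X^i (char_poly A); rewrite -size_poly_eq0 size_char_poly /=.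
  by move=> /(leq_trans (ltn_ord j)).
by rewrite -scalemxAr -scalemxAl (small (Ordinal jk)) scaler0.
Qed.

(** A matrix commuting with [A] is determined by its action on a cyclic vector; once the Krylov
    matrix is invertible, this makes [X] scalar. *)
Lemma krylov_mx_comm A phi X (c : K) :
  A *m X = X *m A -> phi *m X = c *: phi ->
  krylov_mx A phi *m X = c *: krylov_mx A phi.
Proof.
move=> AX phiX; apply/row_matrixP => i; rewrite row_mul linearZ /= !rowK.
have -> : phi *m A ^+ i *m X = phi *m X *m A ^+ i.
  rewrite -!mulmxA; congr (_ *m _).
  by have : GRing.comm X (A ^+ i); [exact/commrX/esym | rewrite /GRing.comm].
by rewrite phiX -scalemxAl.
Qed.

Lemma mxtrace_exp_comm A X i : \tr (A ^+ i *m (A *m X - X *m A)) = 0.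
Proof.
rewrite mulmxBr linearB /= mulmxA [\tr (_ *m (X *m A))]mxtrace_mulC.
rewrite -(mulmxA X) (mxtrace_mulC X) !mulmxE -exprSr -exprS.
by rewrite subrr.
Qed.

(** The scalar [phi A^i u] is the trace of [A^i (u phi) = A^i [A, X]], which is zero because [A^i]
    commutes with [A]. *)
Lemma krylov_mx_orth A phi X u :
  A *m X - X *m A = u *m phi -> krylov_mx A phi *m u = 0.
Proof.
move=> AXu; apply/row_matrixP => i; rewrite row_mul rowK row0.
apply/rowP => j; rewrite ord1 mx0E -trace_mx11 -(mxtrace_exp_comm A X i) AXu.
by rewrite [in RHS]mulmxA [RHS]mxtrace_mulC !mulmxA.
Qed.

(* Right multiplication by [X] is lower triangular on [phi], [phi A], ... *)
Lemma krylov_mx_shift A phi X u (a : K) :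
  A *m X - X *m A - u *m phi = A -> phi *m X = a *: phi ->
  forall i, exists g : nat -> K,
    phi *m A ^+ i *m X = (a + i%:R) *: (phi *m A ^+ i)
      + \sum_(j < i) g j *: (phi *m A ^+ j).
Proof.
move=> eqA phiX; have AX : A *m X = X *m A + u *m phi + A.
  move: eqA => /(canRL (subrK _)) /(canRL (subrK _)) ->.
  by rewrite [LHS]addrC [A + _]addrC addrA.
elim=> [|i [g IH]].
  by exists (fun=> 0); rewrite big_ord0 !addr0 expr0 mulmx1.
(* Moving [X] past one more [A] shifts the old coefficients by one degree, while [u *m phi]
   contributes the scalar [phi A^i u] in degree 0. The remaining summand [A] raises the leading
   coefficient by 1. *)
exists (fun j => if j is j'.+1 then g j' else (phi *m A ^+ i *m u) 0 0).
rewrite big_ord_recl /= exprSr -mulmxE mulmxA -(mulmxA _ A X) AX !mulmxDr.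
rewrite !mulmxA IH mulmxDl -scalemxAl -!mulmxA mulmx_suml.
rewrite [phi *m (A ^+ i *m (u *m phi))]mulmxA.
rewrite (_ : \sum_(j < i) _ = \sum_(j < i) g j *: (phi *m A ^+ j.+1)); last first.
  apply: eq_bigr => j _; rewrite -scalemxAl exprSr -mulmxE mulmxA; congr (_ *: _).
rewrite !mulmxA [phi *m A ^+ i *m u]mx11_scalar mul_scalar_mx expr0 mulmx1.
rewrite -natr1 [a + (_ + 1)]addrA [(_ + 1) *: _]scalerDl scale1r.
rewrite [LHS]addrAC -!addrA; congr (_ + _).
by rewrite [LHS]addrC -addrA [_%:M 0 0]mxE eqxx mulr1n.
Qed.

End Cyclic.

(** The common kernel of all [phi A^i] is nonzero and stable under [A], so over an algebraically
    closed field it contains an eigenvector [v]. *)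
Lemma eigen_krylov (K : numClosedFieldType) k (A : 'M[K]_k.+1) (phi : 'rV_k.+1) :
  krylov_mx A phi \notin unitmx ->
  exists (lam : K) (v : 'cV_k.+1) (psi : 'rV_k.+1),
    [/\ v != 0, psi != 0, A *m v = lam *: v, psi *m A = lam *: psi
      & phi *m v = 0].
Proof.
rewrite -unitmx_tr -row_free_unit -kermx_eq0 => /rowV0Pn[w /sub_kermxP wC wn0].
pose good (v : 'cV[K]_k.+1) := v != 0 /\ forall i, phi *m A ^+ i *m v = 0.
have good0 : good w^T.
  split; first by apply: contraNneq wn0 => /(congr1 trmx); rewrite trmxK trmx0 => ->.
  by apply: krylov_mx_kernel; apply: trmx_inj; rewrite trmx_mul trmxK wC trmx0.
have [v [vn0 vphi] [lam Av]] : exists2 v, good v & exists lam, A *m v = lam *: v.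
  have [s sE] := closed_field_poly_normal (char_poly A).
  have : horner_mx A (\prod_(z <- s) ('X - z%:P)) *m w^T = 0.
    have := Cayley_Hamilton A; rewrite sE (monicP (char_poly_monic A)) scale1r.
    by move=> ->; rewrite mul0mx.
  (* Linear factors of the characteristic polynomial are peeled off one by one: either [v] is
     already an eigenvector for [z], or [(A - z) v] is again good and is killed by the remaining
     factors. *)
  elim: s w^T good0 {sE wC wn0} => [|z s IH] v gv.
    by rewrite big_nil rmorph1 mul1mx => v0; case: gv; rewrite v0 eqxx.
  rewrite big_cons mulrC rmorphM /= -mulmxE -mulmxA => H.
  have zE : horner_mx A ('X - z%:P) *m v = A *m v - z *: v.
    by rewrite rmorphB /= horner_mx_X horner_mx_C mulmxBl mul_scalar_mx.
  have [Avz|nAvz] := eqVneq (A *m v - z *: v) 0.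
    by exists v => //; exists z; apply/eqP; rewrite -subr_eq0 Avz.
  apply: (IH _ _ H); rewrite zE; split=> // i.
  rewrite mulmxBr -scalemxAr gv.2 scaler0 subr0 mulmxA.
  by rewrite -(mulmxA phi) mulmxE -exprSr gv.2.
(* As [lam] is an eigenvalue, [A - lam] is singular and therefore also has a nonzero left kernel. *)
have /rowV0Pn[psi /sub_kermxP psiA psin0] : kermx (A - lam%:M) != 0.
  rewrite kermx_eq0 row_free_unit; apply: contraNN vn0 => uA.
  rewrite -[v](mulKmx uA) mulmxBl Av mul_scalar_mx subrr mulmx0 //.
exists lam, v, psi; split=> //; last by have := vphi 0; rewrite expr0 mulmx1.
by apply/eqP; rewrite -subr_eq0 -mul_mx_scalar -mulmxBr psiA.
Qed.

(** In the Krylov basis [X] becomes the triangular matrix [B] with diagonal [a, a + 1, ...]. These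
    entries are distinct in characteristic zero, so [X] has a full set of independent row
    eigenvectors. *)
Lemma krylov_diag (K : numFieldType) k (A X : 'M[K]_k.+1) (phi : 'rV_k.+1)
    (u : 'cV_k.+1) (a : K) :
  krylov_mx A phi \in unitmx ->
  A *m X - X *m A - u *m phi = A -> phi *m X = a *: phi ->
  exists2 Z, Z \in unitmx & Z *m X = diag_mx (\row_i (a + i%:R)) *m Z.
Proof.
move=> uC eqA phiX; set d := \row_i _.
have [g gE] := fin_all_exists (fun i : 'I_k.+1 => krylov_mx_shift eqA phiX i).
pose B : 'M[K]_k.+1 := \matrix_(i, j)
  if (j < i)%N then g i j else if j == i then a + i%:R else 0.
have CX : krylov_mx A phi *m X = B *m krylov_mx A phi.
  apply/row_matrixP => i; rewrite 2!row_mul rowK gE [RHS]mulmx_sum_row.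
  rewrite (bigID (fun j : 'I_k.+1 => (j < i)%N)) /= [RHS]addrC; congr (_ + _).
    rewrite (bigD1 i) /= ?ltnn // !mxE ltnn eqxx rowK big1 ?addr0 // => j.
    by case/andP=> /negPf nji /negPf nij; rewrite !mxE nji nij scale0r.
  rewrite (big_ord_widen k.+1 (fun j => g i j *: (phi *m A ^+ j))) 1?ltnW //.
  by apply: eq_bigr => j ji; rewrite !mxE ji rowK.
have rootd i : eigenvalue X (d 0 i).
  rewrite eigenvalue_root_char (char_poly_intertwine uC CX) char_poly_trig.
    rewrite rootE horner_prod (bigD1 i) //= !mxE ltnn eqxx !hornerE subrr.
    by rewrite mul0r.
  apply/is_trig_mxP => i' j ij; rewrite mxE ltnNge ltnW //=.
  by case: eqP ij => // ->; rewrite ltnn.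
pose Z := \matrix_i nz_row (eigenspace X (d 0 i)).
have ZX : Z *m X = diag_mx d *m Z.
  apply/row_matrixP => i; rewrite row_mul rowK.
  have /eigenspaceP-> := nz_row_sub (eigenspace X (d 0 i)).
  by apply/rowP => j; rewrite mul_diag_mx !mxE.
exists Z => //; apply: (eigenrows_unitmx _ _ ZX).
  move=> i j; rewrite !mxE => /addrI /eqP; rewrite eqr_nat => /eqP ij.
  exact: val_inj.
by move=> i; rewrite rowK nz_row_eq0; apply: rootd.
Qed.

(** * Radicals and principal elements of matrix functionals *)

Section Functional.
Variables (K : numClosedFieldType) (k m : nat).
Implicit Types (f x : 'M[K]_(k.+1 + m.+1)).

Definition functional_gl f : 'M[K]_k.+1 := ulsubmx f.
Definition functional_col f : 'rV[K]_k.+1 := row 0 (dlsubmx f).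

(* These turn out to be exactly the matrices of the Frobenius functionals. *)
Definition generic_functional f : Prop :=
  krylov_mx (functional_gl f) (functional_col f) \in unitmx /\
  forall o e : 'I_m.+1, path_rel o e -> o != e -> drsubmx f e o != 0.

Lemma generic_functional_nondegenerate f X u T :
  generic_functional f -> path_mx T -> coadjoint_scaled f (block_elt X u T) 0 ->
  block_elt X u T = (T 0 0)%:M.
Proof.
move=> [uC nz] pT Hx.
have AX : functional_gl f *m X - X *m functional_gl f = u *m functional_col f.
  by apply/eqP; rewrite -subr_eq0 (comm_block_gl pT Hx) scale0r.
have u0 : u = 0.
  by rewrite -[u](mulKmx uC) (krylov_mx_orth AX) mulmx0.
have pX : functional_col f *m X = T 0 0 *: functional_col f.
  by rewrite [LHS](comm_block_col pT Hx) addr0.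
have XE : X = (T 0 0)%:M.
  have AX0 : functional_gl f *m X = X *m functional_gl f.
    by apply/eqP; rewrite -subr_eq0 AX u0 mul0mx.
  rewrite -[X](mulKmx uC) (krylov_mx_comm AX0 pX) -scalemxAr mulVmx //.
  by rewrite scalemx1.
have Toe (o e : 'I_m.+1) : path_rel o e -> o != e -> T o e = 0.
  move=> roe noe; have [oo ee] := path_edge roe noe.
  (* Pairing with a cut isolates one edge; vertex 0 is never beyond a cut, so the column term
     disappears. *)
  have := comm_block_path pT Hx (@path_mx_diag _ _ (\row_j (minn o e < j)%:R)).
  rewrite (path_mx_comm_cut pT roe noe) !mxE ltn0 !mul0r add0r.
  rewrite -!scalemxAr !linearZ /= mxtrace_mul_delta => /eqP.
  by rewrite !mulf_eq0 signr_eq0 /= (negPf (nz _ _ roe noe)) orbF => /eqP.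
have Tdiag : forall i j, T i i = T j j.
  apply: path_diag_const => o e roe noe; apply/eqP; rewrite -subr_eq0.
  have /eqP := comm_block_edge pT Hx roe noe.
  by rewrite mul0r mulf_eq0 (negPf (nz _ _ roe noe)).
rewrite scalar_mx_block /block_elt u0 mul0mx -XE; congr block_mx.
apply/matrixP => i j; rewrite mxE; have [->|nij] := eqVneq i j.
  by rewrite mulr1n; apply: Tdiag.
by have [/Toe->|/pT->] := boolP (path_rel i j).
Qed.

(** Each failure of genericity gives a nonscalar solution for [mu = 0]: the rank one block
    [v *m psi] if [phi] is not cyclic, or the matrix unit of an edge on which [f] vanishes. *)
Lemma nondegenerate_generic_functional f :
  (forall X u T, path_mx T -> coadjoint_scaled f (block_elt X u T) 0 ->
     exists c, block_elt X u T = c%:M) ->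
  generic_functional f.
Proof.
move=> H; split=> [|o e roe noe].
  apply/negPn/negP => /eigen_krylov[lam [v [psi [vn0 psin0 Av psiA phiv]]]].
  have [Y w T' pT'|c] := H (v *m psi) 0 0 (@path_mx0 _ _).
    rewrite mul0r block_elt_comm //; last exact: path_mx0.
    rewrite mxtrace_block_elt !(mulmx0, mul0mx, mx0E, scaler0, subr0, scale0r).
    rewrite mxtrace0 addr0 -/(functional_col f) -/(functional_gl f) !mulmxA.
    rewrite phiv !mul0mx mx0E addr0 mulmxBr linearB /= !mulmxA Av.
    rewrite -!scalemxAl linearZ /=.
    rewrite [X in _ - X](_ : _ = \tr (Y *m v *m (psi *m functional_gl f))).
      by rewrite psiA -scalemxAr linearZ /= mxtrace_mulC !mulmxA subrr.
    by rewrite -!mulmxA mxtrace_mulC !mulmxA.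
  (* The path block of this solution is zero, so the scalar would be 0 and [v *m psi] would
     vanish. *)
  rewrite scalar_mx_block => /eq_block_mx[vc _ _ /matrixP/(_ 0 0)].
  rewrite !mxE eqxx mulr1n => c0.
  have [i vi] : exists i, v i 0 != 0 by apply/cV0Pn.
  have [j psij] : exists j, psi 0 j != 0 by apply/rV0Pn.
  have /eqP := congr1 (fun M : 'M_k.+1 => M i j) vc.
  rewrite !mxE big_ord1 -c0 mul0rn mulf_eq0 (negPf vi) (negPf psij) //.
apply: contraNneq (oner_neq0 K) => f0.
have [|Y w T' pT'|c] := H 0 0 (delta_mx o e); first exact: path_mx_delta.
  rewrite mul0r block_elt_comm //; last exact: path_mx_delta.
  have [oo ee] := path_edge roe noe.
  rewrite mxtrace_block_elt !(mulmx0, mul0mx, mx0E, scaler0, subr0).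
  rewrite mxtrace0 add0r -[_ - _ *m delta_mx o e]opprB path_mx_comm_delta //.
  rewrite (_ : \tr _ = 0); last first.
    by rewrite -scaleNr -scalemxAr linearZ /= mxtrace_mul_delta f0 mulr0.
  rewrite [delta_mx o e 0 0]mxE (_ : 0 == o = false) /=; last first.
    by apply: contraTF oo => /eqP<-.
  by rewrite scale0r subrr mulmx0 mx0E addr0.
rewrite scalar_mx_block => /eq_block_mx[_ _ _ /matrixP/(_ o e)].
by rewrite !mxE !eqxx (negPf noe) /= => /eqP.
Qed.

(** The offset [c] is kept because the diagonal form is only reached up to a scalar; it cancels in
    the differences that give the adjoint eigenvalues. *)
Definition principal_weights (c : K) : 'rV[K]_(k.+1 + m.+1) :=
  row_mx (\row_i (c + 1 + i%:R)) (\row_j (c + (odd j)%:R)).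

(** The conjugating matrix and its inverse are both exhibited as block elements, so that conjugation
    preserves the algebra. [Z] treats the full block, [1 + N] the path and [sg] the column. *)
Lemma principal_diag f X u T :
  generic_functional f -> path_mx T -> coadjoint_scaled f (block_elt X u T) 1 ->
  exists Z, exists s, exists S, exists Z', exists s', exists S',
    [/\ path_mx S, path_mx S',
        block_elt Z s S *m block_elt Z' s' S' = 1%:M
      & block_elt Z s S *m block_elt X u T
          = diag_mx (principal_weights (T 0 0)) *m block_elt Z s S].
Proof.
move=> [uC nz] pT Hx; set c := T 0 0.
have eqA : functional_gl f *m X - X *m functional_gl f - u *m functional_col f
           = functional_gl f.
  by rewrite (comm_block_gl pT Hx) scale1r.
have [Z uZ ZX] := krylov_diag uC eqA (comm_block_col pT Hx).
set dX := \row_i _ in ZX.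
have dT (o e : 'I_m.+1) : path_rel o e -> o != e -> T o o = T e e + 1.
  move=> roe noe; have <- : T o o - T e e = 1; last by rewrite addrC subrK.
  apply: (mulfI (nz _ _ roe noe)).
  by rewrite (comm_block_edge pT Hx roe noe) mul1r mulr1.
have Tdiag j : T j j = c + (odd j)%:R.
  suff : T j j - (odd j)%:R = T ord0 ord0 - (odd (ord0 : 'I_m.+1))%:R.
    by rewrite subr0 => /(canRL (subrK _)).
  move: j ord0; apply: path_diag_const => o e roe noe.
  by have [-> /negPf->] := path_edge roe noe; rewrite (dT o e) // subr0 addrK.
pose N : 'M[K]_m.+1 := \matrix_(i, j) if i == j then 0 else T i j.
have pN : path_mx N by move=> i j nij; rewrite mxE (pT _ _ nij) if_same.
have p1 : path_mx (1%:M : 'M[K]_m.+1).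
  by rewrite -diag_const_mx; apply: path_mx_diag.
(* Edges run from even columns to odd rows, so no two of them compose. Hence [1 - N] is the inverse
   of [1 + N]. *)
have NN : N *m N = 0.
  apply/matrixP => i j; rewrite !mxE big1 // => l _; rewrite !mxE.
  case: eqP => [_|/eqP nil]; first by rewrite mul0r.
  case: eqP => [_|/eqP nlj]; first by rewrite mulr0.
  case ol : (odd l); first by rewrite (path_mx_odd pT ol nil) mul0r.
  by rewrite (path_mx_even pT (negbT ol) nlj) mulr0.
(* Comparing columns requires [(c + 1 + i) sg_i = (Z u)_i + c sg_i], and [1 + i] is nonzero in
   characteristic zero. *)
pose sg : 'cV[K]_k.+1 := \col_i ((Z *m u) i 0 / (1 + i%:R)).
have pNp : path_mx (1%:M + N) by apply: path_mxD.
have pNm : path_mx (1%:M - N) by apply: path_mxD => //; apply: path_mxN.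
exists Z, sg, (1%:M + N), (invmx Z), (- (invmx Z *m sg)), (1%:M - N).
have N0 : N 0 0 = 0 by rewrite mxE eqxx.
split=> //; rewrite /block_elt mulmx_block !(mulmx0, mul0mx, addr0, add0r).
  rewrite mulmxV // mulmxA mulmxN (mulKVmx uZ) -(mulmxA sg) (path_mx_row0 pNm).
  rewrite mxBE N0 mxE eqxx subr0 scale1r mulNmx addNr.
  rewrite mulmxDl mul1mx mulmxBr NN mulmx1 subr0 subrK.
  by rewrite -scalar_mx_block.
rewrite diag_mx_row mulmx_block !(mulmx0, mul0mx, addr0, add0r).
congr block_mx.
- by rewrite ZX; congr (diag_mx _ *m _); apply/rowP => i; rewrite !mxE.
- rewrite -(mulmxA sg) (path_mx_row0 pT) mulmxA mulmxA -scalemxAr scalemxAl.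
  rewrite -mulmxDl; congr (_ *m _); apply/colP => i.
  rewrite mul_diag_mx !mxE -/c.
  have ni : 1 + i%:R != 0 :> K by rewrite nat1r pnatr_eq0.
  by field.
have NTE i j : (N *m T) i j = N i j * (c + (odd j)%:R).
  rewrite mxE (bigD1 j) //= big1 ?addr0 ?Tdiag // => l lj; rewrite mxE.
  case: eqP => [_|/eqP il]; first by rewrite mul0r.
  case ol: (odd l); first by rewrite (path_mx_odd pT ol il) mul0r.
  by rewrite (path_mx_even pT (negbT ol) lj) mulr0.
rewrite mulmxDl mul1mx mul_diag_mx; apply/matrixP => i j.
rewrite [LHS]mxE NTE !mxE; have [->|nij] := eqVneq i j.
  by rewrite Tdiag mul0r addr0 mulr1n addr0 mulr1.
rewrite mulr0n add0r; have [rij|/pT->] := boolP (path_rel i j); last first.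
  by rewrite !(mul0r, mulr0) addr0.
have [-> /negPf->] := path_edge rij nij; rewrite /=; ring.
Qed.

End Functional.

(** * From flags to vanishing matrix entries *)

Section Flags.
Variables (K : fieldType) (n : nat).

Lemma mem_span_delta (P : pred 'I_n) (v : 'cV[K]_n) :
  v \in (\sum_(j | P j) <[delta_mx j 0%R]>)%VS <->
  forall j, ~~ P j -> v j 0 = 0.
Proof.
split=> [/memv_sumP[w wP ->] j nPj | v0].
  rewrite summxE big1 // => i Pi; have /vlineP[c ->] := wP i Pi.
  rewrite !mxE; case: eqP => [ij|_]; last by rewrite mulr0.
  by rewrite ij Pi in nPj.
have -> : v = \sum_(j | P j) v j 0 *: delta_mx j 0.
  rewrite [LHS]matrix_sum_delta (bigID P) /= [X in _ + X]big1 ?addr0.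
    by apply: eq_bigr => j _; rewrite big_ord1.
  by move=> j nPj; rewrite big_ord1 v0 // scale0r.
by apply: memv_sumr => j Pj; apply: rpredZ; apply: memv_line.
Qed.

Lemma stabilizes_coordinates (P : pred 'I_n) (x : 'M[K]_n) :
  let U := (\sum_(j | P j) <[delta_mx j 0%R : 'cV[K]_n]>)%VS in
  (forall v, v \in U -> x *m v \in U) <->
  (forall p q, ~~ P p -> P q -> x p q = 0).
Proof.
split=> [H p q nPp Pq | H v /mem_span_delta v0].
  have /H/mem_span_delta/(_ p nPp) : (delta_mx q 0 : 'cV[K]_n) \in
      (\sum_(j | P j) <[delta_mx j 0%R : 'cV[K]_n]>)%VS.
    apply/mem_span_delta => j nPj; rewrite mxE.
    by case: eqP => // jq; rewrite jq Pq in nPj.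
  by rewrite mulmx_deltaE eqxx mulr1.
apply/mem_span_delta => p nPp; rewrite mxE big1 // => q _.
have [Pq|nPq] := boolP (P q); first by rewrite H ?mul0r.
by rewrite v0 ?mulr0.
Qed.

(** All members of the two flags are coordinate subspaces, so preserving one of them means that a
    rectangle of entries is zero. *)
Lemma mem_seaweed_entries a b (x : 'M[K]_n) :
  x \in seaweed K n a b <->
  [/\ \tr x = 0,
      forall i (p q : 'I_n), (i <= size a)%N ->
        (q < sumn (take i a) <= p)%N -> x p q = 0
    & forall j (p q : 'I_n), (j <= size b)%N ->
        (p < sumn (take j b) <= q)%N -> x p q = 0].
Proof.
split=> [/mem_seaweed[tr0 Ha Hb] | [tr0 Ha Hb]].
  split=> // i p q le_i /andP[]; rewrite ?[(p < _)%N]ltnNge.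
    rewrite [(_ <= p)%N]leqNgt => qs ps.
    by have /stabilizes_coordinates := Ha i ^~ le_i; apply.
  move=> ps qs.
  by have /stabilizes_coordinates := Hb i ^~ le_i; apply.
apply/mem_seaweed; split=> // i v le_i; move: v; apply/stabilizes_coordinates.
  by move=> p q; rewrite -leqNgt => ps qs; apply: (Ha i); rewrite ?qs.
by move=> p q; rewrite -ltnNge => ps qs; apply: (Hb i); rewrite ?qs ?ps.
Qed.

End Flags.

(** * Existence and uniqueness of principal elements *)

Section PrincipalElement.
Variables (K : fieldType) (L : vectType K) (br : L -> L -> L).
Hypothesis br_linearr : forall x, linear (br x).

Lemma adE x y : ad br x y = br x y.
Proof.
pose h : {linear L -> L} :=
  HB.pack (br x) (GRing.isLinear.Build _ _ _ _ (br x) (br_linearr x)).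
by rewrite /ad (lfunE h).
Qed.

Hypothesis br_linearl : forall y, linear (br^~ y).

(* On a finite dimensional space, injectivity of [x |-> F (br x _)] gives
   surjectivity onto the dual. *)
Lemma principal_element_unique F :
  nondegenerate_functional br F -> exists Fh, unique (principal_element br F) Fh.
Proof.
move=> nd; pose e := vbasis {:L}.
(* The functional [F (br x _)] is encoded by its values on [e], placed back in [L], so that the
   dimension argument concerns an endomorphism. *)
pose Th x := \sum_(j < \dim {:L}) F (br x e`_j) *: e`_j.
have Th_lin : linear Th.
  move=> c x y; rewrite /Th scaler_sumr -big_split /=; apply: eq_bigr => j _.
  by rewrite br_linearl linearP /= scalerDl scalerA.
pose h : {linear L -> L} := HB.pack Th (GRing.isLinear.Build _ _ _ _ Th Th_lin).
have fe : free e := basis_free (vbasisP _).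
have onbasis x y : (forall j : 'I_(\dim {:L}), F (br x e`_j) = F (br y e`_j)) ->
    forall z, F (br x z) = F (br y z).
  move=> H z; rewrite (coord_vbasis (memvf z)) -!adE !linear_sum /=.
  by apply: eq_bigr => j _; rewrite !linearZ /= !adE H.
have ThE x y : Th x = Th y -> forall z, F (br x z) = F (br y z).
  move=> H; apply: onbasis => j.
  by have := congr1 (coord e j) H; rewrite !coord_sum_free.
have Th_inj : lker (linfun h) == 0%VS.
  apply/lker0P => x y; rewrite !lfunE /= => /ThE H; apply/eqP.
  rewrite -subr_eq0; apply/eqP/nd => z.
  have -> : x - y = -1 *: y + x by rewrite scaleN1r addrC.
  by rewrite br_linearl linearP /= H scaleN1r addNr.
have : \sum_(j < \dim {:L}) F e`_j *: e`_j \in limg (linfun h).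
  by rewrite (lker0_limgf Th_inj) memvf.
case/memv_imgP => x _; rewrite lfunE /= => xE.
have xP : principal_element br F x.
  move=> z; rewrite [z in RHS](coord_vbasis (memvf z)) [z in LHS](coord_vbasis (memvf z)).
  rewrite -adE !linear_sum /=; apply: eq_bigr => j _; rewrite !linearZ /= adE.
  by have := congr1 (coord e j) xE; rewrite !coord_sum_free // => ->.
exists x; split=> // y yP; apply/eqP; rewrite -subr_eq0; apply/eqP/nd => z.
have -> : x - y = -1 *: y + x by rewrite scaleN1r addrC.
by rewrite br_linearl linearP /= xP yP scaleN1r addNr.
Qed.

End PrincipalElement.

Definition supported (K : nmodType) n (S : rel 'I_n) (x : 'M[K]_n) : Prop :=
  forall p q, ~~ S p q -> x p q = 0.

Lemma supportedM (K : pzSemiRingType) n (S : rel 'I_n) (x y : 'M[K]_n) :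
  transitive S -> supported S x -> supported S y -> supported S (x *m y).
Proof.
move=> trS Sx Sy p q npq; rewrite mxE big1 // => l _.
have [pl|/Sx->] := boolP (S p l); last by rewrite mul0r.
have [lq|/Sy->] := boolP (S l q); last by rewrite mulr0.
by rewrite (trS _ _ _ pl lq) in npq.
Qed.

(** * Seaweeds as trace-zero parts of incidence algebras *)

Section IncidenceSeaweed.
Variables (K : numFieldType) (n : nat) (a b : seq nat).
Local Notation L := (subvs_of (seaweed K n a b)).
Local Notation br := (@seaweed_bracket K n a b).

Lemma seaweed_bracket_linearr (x : L) : linear (br x).
Proof.
move=> c y z; apply: val_inj; rewrite [RHS]linearP.
have vsvalP v w : vsval (c *: v + w : L) = c *: vsval v + vsval w by exact: linearP.
rewrite -[LHS]/(vsval x *m vsval (c *: y + z) - vsval (c *: y + z) *m vsval x).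
rewrite vsvalP mulmxDr mulmxDl -scalemxAr -scalemxAl opprD addrACA.
by rewrite -scalerBr.
Qed.

Lemma seaweed_bracket_linearl (y : L) : linear (br^~ y).
Proof.
move=> c x z; apply: val_inj; rewrite [RHS]linearP.
have vsvalP v w : vsval (c *: v + w : L) = c *: vsval v + vsval w by exact: linearP.
rewrite -[LHS]/(vsval (c *: x + z) *m vsval y - vsval y *m vsval (c *: x + z)).
rewrite vsvalP mulmxDr mulmxDl -scalemxAr -scalemxAl opprD addrACA.
by rewrite -scalerBr.
Qed.

Variable S : rel 'I_n.
Hypothesis n_gt0 : (0 < n)%N.
Hypothesis S_refl : reflexive S.
Hypothesis memS : forall x, x \in seaweed K n a b <-> \tr x = 0 /\ supported S x.

Lemma supported_traceless y : supported S y ->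
  y - (\tr y / n%:R)%:M \in seaweed K n a b.
Proof.
move=> Sy; apply/memS; split.
  by rewrite linearB /= mxtrace_scalar -[X in _ - X]mulr_natr divfK ?subrr //
             pnatr_eq0 -lt0n.
move=> p q npq; rewrite !mxE Sy // sub0r.
by case: eqP npq => [->|_]; rewrite ?S_refl ?mulr0n ?oppr0.
Qed.

(** The functional extends to all supported matrices, with value 0 on scalars. Equations known on
    the seaweed can then be tested on matrices of any trace, [y'] being the traceless part of
    [y]. *)
Lemma functional_matrix (F : 'Hom(L, K^o)) :
  exists f, (forall y : L, F y = \tr (f *m vsval y)) /\
    forall y, supported S y -> exists y' : L, F y' = \tr (f *m y) /\
      forall x : L, F (br x y') = \tr (f *m (vsval x *m y - y *m vsval x)).
Proof.
pose U := seaweed K n a b.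
pose f0 : 'M[K]_n := \matrix_(i, j) F (vsproj U (delta_mx j i)).
(* Removing the trace of [f0] changes nothing on traceless elements and makes the extension vanish
   on scalars. *)
pose f := f0 - (\tr f0 / n%:R)%:M.
have trf : \tr f = 0.
  by rewrite linearB /= mxtrace_scalar -[X in _ - X]mulr_natr divfK ?subrr //
             pnatr_eq0 -lt0n.
have FE (y : L) : F y = \tr (f *m vsval y).
  have /memS[try _] := subvsP y.
  rewrite mulmxBl linearB /= mul_scalar_mx linearZ /= try mulr0 subr0.
  have -> : \tr (f0 *m vsval y) = \sum_i \sum_j vsval y i j * F (vsproj U (delta_mx i j)).
    rewrite exchange_big /=; apply: eq_bigr => j _; rewrite mxE.
    by apply: eq_bigr => i _; rewrite mxE mulrC.
  rewrite -[y in LHS]vsvalK {1}[vsval y]matrix_sum_delta !linear_sum /=.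
  apply: eq_bigr => i _; rewrite !linear_sum /=; apply: eq_bigr => j _.
  by rewrite !linearZ.
exists f; split=> // y Sy; exists (Subvs (supported_traceless Sy)).
rewrite FE /=; split=> [|x].
  by rewrite mulmxBr linearB /= mul_mx_scalar linearZ /= trf mulr0 subr0.
rewrite FE; congr (\tr (_ *m _)).
by rewrite /= mulmxBr mulmxBl scalar_mxC opprB addrA subrK.
Qed.

Hypothesis S_trans : transitive S.

(** Conjugation by [Q] turns [ad x] into the adjoint action of [diag_mx d], which is diagonal on
    matrix units. The trace condition costs one diagonal position, here [(l, l)]. *)
Lemma char_poly_ad (l : 'I_n) (x : L) (Q Q' : 'M_n) (d : 'rV[K]_n) :
  supported S Q -> supported S Q' -> Q *m Q' = 1%:M ->
  Q *m vsval x = diag_mx d *m Q ->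
  char_poly (mxof (vbasis {:L}) (vbasis {:L}) (ad br x)) =
    \prod_(z | S z.1 z.2 && (z != (l, l)))
       ('X - (d 0 z.1 - d 0 z.2)%:P).
Proof.
move=> SQ SQ' QQ' Qx.
have Q'Q : Q' *m Q = 1%:M by apply: mulmx1C.
have xE : vsval x = Q' *m (diag_mx d *m Q) by rewrite -Qx mulmxA Q'Q mul1mx.
pose P (z : 'I_n * 'I_n) := S z.1 z.2 && (z != (l, l)).
(* Diagonal units are made traceless by subtracting the unit at [(l, l)]; off the diagonal the
   correction is zero. *)
pose E (z : 'I_n * 'I_n) : 'M[K]_n :=
  delta_mx z.1 z.2 - (z.1 == z.2)%:R *: delta_mx l l.
have SE z : P z -> supported S (Q' *m E z *m Q).
  case/andP=> Sz _; apply: supportedM => //; apply: supportedM => // p q npq.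
  rewrite !mxE [X in _ * X](_ : _ = 0) ?mulr0 ?subr0; last first.
    by case: (eqVneq p l) npq => [->|//]; case: (eqVneq q l) => [->|//]; rewrite S_refl.
  by case: (eqVneq p z.1) npq => [->|//]; case: (eqVneq q z.2) => [->|//]; rewrite Sz.
have trE z : \tr (E z) = 0.
  rewrite linearB /= linearZ /=.
  have trd i j : \tr (delta_mx i j : 'M[K]_n) = (i == j)%:R.
    by rewrite -[delta_mx i j]mul1mx mxtrace_mul_delta mxE eq_sym.
  by rewrite !trd eqxx mulr1 subrr.
have LE z : P z -> Q' *m E z *m Q \in seaweed K n a b.
  move=> Pz; apply/memS; split; last exact: SE.
  by rewrite mxtrace_mulC mulmxA QQ' mul1mx trE.
pose w z : L := vsproj _ (Q' *m E z *m Q).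
have wE z : P z -> vsval (w z) = Q' *m E z *m Q by move=> Pz; rewrite vsprojK ?LE.
rewrite -big_filter.
set s := filter _ _.
have sP z : (z \in s) = P z by rewrite mem_filter mem_index_enum andbT.
apply: (@char_poly_mxof_eigenbasis _ _ _ _ _ w (fun z => d 0 z.1 - d 0 z.2)); last first.
  move=> z; rewrite sP => Pz; rewrite adE; last exact: seaweed_bracket_linearr.
  apply: val_inj; rewrite [RHS]linearZ [LHS]/= (wE z Pz) xE.
  have -> : Q' *m (diag_mx d *m Q) *m (Q' *m E z *m Q)
          - Q' *m E z *m Q *m (Q' *m (diag_mx d *m Q))
          = Q' *m (diag_mx d *m E z - E z *m diag_mx d) *m Q.
    rewrite (mulmxBr Q' (diag_mx d *m E z)) mulmxBl; congr (_ - _).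
      by rewrite -!mulmxA [Q *m (Q' *m _)]mulmxA QQ' mul1mx.
    by rewrite -!mulmxA [Q *m (Q' *m _)]mulmxA QQ' mul1mx.
  rewrite (_ : diag_mx d *m E z - _ = (d 0 z.1 - d 0 z.2) *: E z).
    by rewrite -(scalemxAr _ Q' (E z)) -scalemxAl -(wE z Pz).
  apply/matrixP => p q; rewrite mul_diag_mx mul_mx_diag !mxE.
  set t := (_ && _)%:R; set e := (z.1 == z.2)%:R; set v := ((p == l) && _)%:R.
  have tp : d 0 p * t = d 0 z.1 * t.
    by rewrite /t; case: eqP => [->|] //=; rewrite !mulr0.
  have tq : d 0 q * t = d 0 z.2 * t.
    by rewrite /t; case: (q =P _) => [->|] //=; rewrite andbF !mulr0.
  have vp : d 0 p * v = d 0 l * v.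
    by rewrite /v; case: eqP => [->|] //=; rewrite !mulr0.
  have vq : d 0 q * v = d 0 l * v.
    by rewrite /v; case: (q =P _) => [->|] //=; rewrite andbF !mulr0.
  have e0 : d 0 z.1 * e = d 0 z.2 * e.
    by rewrite /e; case: eqP => [->|] //=; rewrite !mulr0.
  rewrite mulrBr mulrBl ![_ * d 0 q]mulrC tp tq mulrCA vp [d 0 q * _]mulrCA vq.
  by rewrite [RHS]mulrBr mulrA [(_ - _) * e]mulrBl e0; ring.
have us : uniq s by rewrite filter_uniq // index_enum_uniq.
(* The dual functionals read entries of the conjugated element; the correction at [(l, l)] is
   invisible to them, as that position is excluded. *)
pose hf z (y : L) : K^o := (Q *m vsval y *m Q') z.1 z.2.
have hf_lin z : linear (hf z).
  move=> c y y'; rewrite /hf.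
  have -> : vsval (c *: y + y') = c *: vsval y + vsval y' by exact: linearP.
  rewrite mulmxDr mulmxDl -scalemxAr -scalemxAl.
  by rewrite mxE; congr (_ + _); rewrite mxE.
pose hl z : {linear L -> K^o} :=
  HB.pack (hf z) (GRing.isLinear.Build _ _ _ _ (hf z) (hf_lin z)).
pose h z : 'Hom(L, K^o) := linfun (hl z).
apply: (@basis_of_dual _ _ _ _ _ h) => // [z z'|y Hy].
  rewrite !sP => Pz Pz'; rewrite lfunE /= /hf wE //.
  have -> : Q *m (Q' *m E z' *m Q) *m Q' = E z'.
    by rewrite !mulmxA QQ' mul1mx -mulmxA QQ' mulmx1.
  rewrite !mxE [X in _ * X](_ : _ = 0) ?mulr0 ?subr0.
    by rewrite -pair_eqE /=.
  case: eqP => //= z1; case: eqP => //= z2; case/andP: Pz => _.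
  by rewrite -pair_eqE /= z1 z2 !eqxx.
apply: val_inj; rewrite linear0.
have /memS[try Sy] := subvsP y.
suff y0 : Q *m vsval y *m Q' = 0.
  have : Q' *m (Q *m vsval y *m Q') *m Q = 0 by rewrite y0 mulmx0 mul0mx.
  by rewrite !mulmxA Q'Q mul1mx -mulmxA Q'Q mulmx1.
have off p q : (p, q) != (l, l) -> (Q *m vsval y *m Q') p q = 0.
  move=> npq; have [Spq|nS] := boolP (S p q).
    have := Hy (p, q); rewrite sP /P /= Spq npq => /(_ isT).
    by rewrite lfunE.
  by rewrite (supportedM S_trans (supportedM S_trans SQ Sy) SQ').
apply/matrixP => p q; rewrite [RHS]mxE.
have [[-> ->]|/off//] := eqVneq (p, q) (l, l).
(* Only the entry at [(l, l)] is left, and the zero trace determines it. *)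
have : \tr (Q *m vsval y *m Q') = 0.
  by rewrite mxtrace_mulC mulmxA Q'Q mul1mx.
rewrite /mxtrace (bigD1 l) //= big1 ?addr0 // => i il.
by rewrite off // -pair_eqE /= negb_and il.
Qed.

End IncidenceSeaweed.

(** * Products over the weight differences *)

Section SpectrumProduct.
Variables (R : comNzRingType) (g : int -> R).

(** The exponents count the vertices and the edges of the path. In the induction the new vertex
    [m.+1] is joined only to [m]. *)
Lemma prod_path_rel m :
  \prod_(i < m.+1) \prod_(j < m.+1 | path_rel i j) g ((odd i)%:Z - (odd j)%:Z)
  = g 0 ^+ m.+1 * g 1 ^+ m.
Proof.
pose F i j := if path_rel i j then g ((odd i)%:Z - (odd j)%:Z) else 1.
transitivity (\prod_(i < m.+1) \prod_(j < m.+1) F i j).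
  by apply: eq_bigr => i _; rewrite big_mkcond.
have far i j : (i.+1 < j)%N -> F i j = 1 /\ F j i = 1.
  by move=> ij; rewrite /F !ifF //; rewrite /path_rel; lia.
elim: m => [|m IH]; first by rewrite !big_ord1 /F /= subrr expr1 expr0 mulr1.
rewrite big_ord_recr /=.
under eq_bigr do rewrite big_ord_recr /=.
rewrite big_split /= IH [\prod_(j < m.+2) _]big_ord_recr /=.
rewrite 2![\prod_(_ < m.+1) _]big_ord_recr /= !big1 ?mul1r; first last.
- by move=> i _; have [] := far i m.+1 (ltn_ord i).
- by move=> i _; have [] := far i m.+1 (ltn_ord i).
have -> : F m.+1 m.+1 = g 0 by rewrite /F /path_rel eqxx subrr.
(* Exactly one of the two orientations is allowed, the one with an odd row, so the difference is
   always 1. *)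
have E : F m m.+1 * F m.+1 m = g 1.
  have -> : F m m.+1 = if odd m then g 1 else 1.
    have p : path_rel m m.+1 = odd m by rewrite /path_rel; lia.
    by rewrite /F p; case: ifP => // om; rewrite /= om.
  have -> : F m.+1 m = if odd m then 1 else g 1.
    have p : path_rel m.+1 m = ~~ odd m by rewrite /path_rel; lia.
    by rewrite /F p; case: ifPn; rewrite ?negbK => om; rewrite ?om //= (negPf om).
  by case: (odd m); rewrite ?mul1r ?mulr1.
by rewrite -mulrA [F m m.+1 * _]mulrA E [g 1 * g 0]mulrC mulrACA -!exprSr.
Qed.

(** If the column is read as an extra index [j = -1], the left side runs over differences [i - j];
    for [1 <= i < k] both [-i] and [i + 1] occur [k - i] times. *)
Lemma prod_affine k :
  (\prod_(i < k) \prod_(j < k) g (i%:Z - j%:Z)) * \prod_(i < k) g i.+1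
  = g 0 ^+ k * g 1 ^+ k *
    \prod_(1 <= i < k) (g (- i%:Z) * g i.+1) ^+ (k - i).
Proof.
elim: k => [|k IH]; first by rewrite !big_ord0 big_geq // !expr0 !mulr1.
have -> : \prod_(1 <= i < k.+1) (g (- i%:Z) * g i.+1) ^+ (k.+1 - i)
        = \prod_(1 <= i < k) (g (- i%:Z) * g i.+1) ^+ (k - i)
          * \prod_(1 <= i < k.+1) (g (- i%:Z) * g i.+1).
  have -> : \prod_(1 <= i < k) (g (- i%:Z) * g i.+1) ^+ (k - i)
          = \prod_(1 <= i < k.+1) (g (- i%:Z) * g i.+1) ^+ (k - i).
    case: k {IH} => [|k]; first by rewrite !big_geq.
    by rewrite [RHS]big_nat_recr //= subnn expr0 mulr1.
  rewrite -big_split big_nat [RHS]big_nat; apply: eq_bigr => i /andP[_ ik].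
  by rewrite subSn // exprSr.
rewrite big_ord_recr /=.
under eq_bigr do rewrite big_ord_recr /=.
rewrite big_split /= [\prod_(j < k.+1) g (k%:Z - _)]big_ord_recr /= subrr.
rewrite [\prod_(i < k.+1) g i.+1]big_ord_recr /=.
have E1 : \prod_(i < k) g (i%:Z - k%:Z) = \prod_(1 <= i < k.+1) g (- i%:Z).
  rewrite big_add1 /= big_mkord (reindex_inj rev_ord_inj) /=.
  by apply: eq_bigr => i _; congr g; have := ltn_ord i; lia.
have E2 : (\prod_(j < k) g (k%:Z - j%:Z)) * g k.+1
        = g 1 * \prod_(1 <= i < k.+1) g i.+1.
  rewrite big_add1 /= big_mkord (reindex_inj rev_ord_inj) /=.
  rewrite (_ : \prod_(j < k) _ = \prod_(j < k) g j.+1).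
    transitivity (\prod_(j < k.+1) g j.+1); first by rewrite big_ord_recr.
    by rewrite big_ord_recl.
  by apply: eq_bigr => i _; congr g; have := ltn_ord i; lia.
rewrite E1 big_split /= !exprSr.
set a := \prod_(i < k) \prod_(j < k) _ in IH *; set b := \prod_(i < k) g i.+1 in IH *.
set c := \prod_(1 <= i < k.+1) g _; set d := \prod_(1 <= i < k) _ in IH *.
set e := \prod_(j < k) _ in E2 *; set h := \prod_(1 <= i < k.+1) _ in E2 *.
transitivity ((a * b) * (c * (e * g k.+1) * g 0)); first by ring.
by rewrite IH E2; ring.
Qed.

End SpectrumProduct.

(** * Multiplicities and unimodality *)

Section Blocks.
Variables (K : numFieldType) (v : nat -> K) (mu : nat -> nat).
Hypothesis v_incr : {homo v : i j / (i < j)%N >-> i < j}.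

(** The values [v j], being strictly increasing, are already the sorted list without duplicates.
    Reality makes [sort] meaningful for the partial order of [K]. *)
Lemma multiplicities_blocks l : (forall j, (j < l)%N -> (0 < mu j)%N) ->
  {subset [seq v j | j <- iota 0 l] <= Num.real} ->
  multiplicities (flatten [seq nseq (mu j) (v j) | j <- iota 0 l])
    = [seq mu j | j <- iota 0 l].
Proof.
move=> mu_gt0 vreal; set u := flatten _.
have v_inj : injective v.
  by move=> i j vij; case: (ltngtP i j) => // /v_incr; rewrite vij ltxx.
have memu : u =i [seq v j | j <- iota 0 l].
  move=> x; apply/flatten_mapP/mapP => -[j jl].
    by rewrite mem_nseq => /andP[_ /eqP->]; exists j.
  move=> ->; exists j => //; rewrite mem_nseq eqxx andbT mu_gt0 //.
  by move: jl; rewrite mem_iota.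
have ->: multiplicities u = [seq count_mem x u | x <- [seq v j | j <- iota 0 l]].
  congr map; apply: le_sorted_eq.
  - apply: (sort_sorted_in (P := Num.real)).
      by move=> x y xr yr; apply: real_leVge.
    by apply/allP => x; rewrite mem_undup memu => /vreal.
  - rewrite sorted_map; apply: sub_sorted (iota_ltn_sorted 0 l).
    by move=> i j ij; apply/ltW/v_incr.
  rewrite perm_sort; apply: uniq_perm; rewrite ?undup_uniq ?map_inj_uniq ?iota_uniq //.
  by move=> x; rewrite mem_undup memu.
rewrite -map_comp; apply/eq_in_map => j jl /=.
rewrite count_flatten -map_comp sumnE big_map (bigD1_seq j) ?iota_uniq //=.
rewrite count_nseq /= eqxx mul1n big1 ?addn0 // => i ij.
by rewrite count_nseq /= (inj_eq v_inj) (negPf ij).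
Qed.

End Blocks.

(** This is the multiplicity of the eigenvalue [j - k] when the full block has size [k.+1]:
    eigenvalues run from [-k] to [k + 1], with the value [m] at 0 and 1. *)
Definition spectrum_multiplicity k m j : nat :=
  if (j < k)%N then j.+1 else if (j <= k.+1)%N then m else (2 * k.+1 - j)%N.

(** The peak is at index [k], the eigenvalue 0; the plateau of height [m] dominates its neighbours,
    of height at most [k]. *)
Lemma unimodal_spectrum_multiplicity k m : (k <= m)%N ->
  unimodal [seq spectrum_multiplicity k m j | j <- iota 0 (2 * k.+1)].
Proof.
move=> km; exists k; rewrite -map_take -map_drop take_iota drop_iota !sorted_map.
split; apply/(sortedP 0%N) => i; rewrite size_iota => il.
  rewrite /relpre /= !nth_iota ?add0n; try lia.
  by rewrite /spectrum_multiplicity; do ?case: ifPn => ?; lia.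
rewrite /relpre /= !nth_iota; try lia.
by rewrite /spectrum_multiplicity; do ?case: ifPn => ?; lia.
Qed.

Lemma prod_spectrum_multiplicity (R : comNzRingType) (g : int -> R) k m :
  \prod_(0 <= j < 2 * k.+1) g (j%:Z - k%:Z) ^+ spectrum_multiplicity k m j
  = g 0 ^+ m * g 1 ^+ m *
    \prod_(1 <= i < k.+1) (g (- i%:Z) * g i.+1) ^+ (k.+1 - i).
Proof.
rewrite (big_cat_nat (n := k)) /=; [|lia|lia].
rewrite [X in _ * X](big_cat_nat (n := k.+2)) /=; [|lia|lia].
rewrite (_ : \prod_(k <= j < k.+2) _ = g 0 ^+ m * g 1 ^+ m); last first.
  rewrite big_nat_recl // big_nat1 /spectrum_multiplicity ltnn leqnSn subrr.
  by rewrite ltnNge leqnSn leqnn /=; congr (_ * g _ ^+ _); lia.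
rewrite mulrCA; congr (_ * _); under [RHS]eq_bigr do rewrite exprMn.
rewrite big_split /=; congr (_ * _).
  rewrite big_nat_rev /= [RHS]big_add1 /= big_nat [RHS]big_nat.
  apply: eq_bigr => i ik; rewrite /spectrum_multiplicity ifT; last lia.
  by congr (g _ ^+ _); lia.
rewrite (_ : k.+2 = (1 + k.+1)%N) // big_addn (_ : 2 * k.+1 - k.+1 = k.+1)%N; last lia.
rewrite big_nat [RHS]big_nat; apply: eq_bigr => i ik.
rewrite /spectrum_multiplicity ifF; last lia.
by rewrite ifF; last lia; congr (g _ ^+ _); lia.
Qed.

Definition seaweed_spectrum (K : fieldType) (N k : nat) : seq K :=
  nseq N 0 ++ nseq N 1 ++
  flatten [seq nseq i (- k%:R + i%:R) ++ nseq i (k%:R - i%:R + 1)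
          | i <- index_iota 1 k].

Lemma prod_nseq (R : comNzRingType) (T : Type) (g : T -> R) n x :
  \prod_(z <- nseq n x) g z = g x ^+ n.
Proof. by rewrite big_nseq -Monoid.iteropE. Qed.

Lemma prod_seaweed_spectrum (K : fieldType) N k :
  \prod_(z <- seaweed_spectrum K N k) ('X - z%:P)
  = let g (z : int) : {poly K} := 'X - (z%:~R)%:P in
    g 0 ^+ N * g 1 ^+ N * \prod_(1 <= i < k) (g (- i%:Z) * g i.+1) ^+ (k - i).
Proof.
rewrite /= /seaweed_spectrum !big_cat /= !prod_nseq mulrA; congr (_ * _).
rewrite big_flatten big_map big_nat_rev /= big_nat [RHS]big_nat.
apply: eq_bigr => i /andP[i1 ik].
rewrite big_cat /= !prod_nseq add1n subSS -exprMn (natrB _ (ltnW ik)).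
congr ((('X - _%:P) * ('X - _%:P)) ^+ _); first by rewrite rmorphN /=; ring.
by rewrite -[_%:~R]/(i.+1%:R) -natr1; ring.
Qed.

(** A spectrum is fixed only up to order, so it is listed by increasing eigenvalue; the two listings
    are compared through their products of linear factors. *)
Lemma unimodal_multiplicities_seaweed (K : numFieldType) N k : (k < N)%N ->
  exists s : seq K, [/\ \prod_(z <- s) ('X - z%:P)
      = \prod_(z <- seaweed_spectrum K N k.+1) ('X - z%:P),
    {subset s <= Num.real} & unimodal (multiplicities s)].
Proof.
move=> kN; pose v j : K := (j%:Z - k%:Z)%:~R.
pose mu := spectrum_multiplicity k N.
have vreal j : v j \is Num.real by exact: realz.
exists (flatten [seq nseq (mu j) (v j) | j <- iota 0 (2 * k.+1)]); split.
- rewrite prod_seaweed_spectrum; cbv zeta.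
  rewrite -(prod_spectrum_multiplicity (fun z : int => 'X - (z%:~R)%:P)).
  rewrite big_flatten big_map.
  by rewrite /index_iota subn0; apply: eq_bigr => j _; rewrite prod_nseq.
- move=> x /flatten_mapP[j _]; rewrite mem_nseq => /andP[_ /eqP->].
  exact: vreal.
rewrite multiplicities_blocks.
- exact/unimodal_spectrum_multiplicity/ltnW.
- by move=> i j ij; rewrite ltr_int; lia.
- by move=> j jl; rewrite /mu /spectrum_multiplicity; do ?case: ifPn => ?; lia.
by move=> x /mapP[j _ ->].
Qed.

(** * Positions allowed by the two compositions *)

(* Entries [(p, q)] allowed by both flags: after removing the diagonal blocks of
   size [k] (top) and [k + 1] (bottom), the blocks of size 2 on the two sides are
   shifted by one and only leave a path. *)
Definition sw_rel (k p q : nat) : bool :=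
  if (p < k)%N then (q <= k)%N else (k <= q)%N && path_rel (p - k) (q - k).

Lemma sw_rel_trans k : transitive (sw_rel k).
Proof.
move=> q p r; rewrite /sw_rel /path_rel.
by case: (ltnP p k) => pk; case: (ltnP q k) => qk; lia.
Qed.

Lemma sw_rel_refl k : reflexive (sw_rel k).
Proof.
by move=> p; rewrite /sw_rel /path_rel eqxx; case: ltnP => // /ltnW.
Qed.

(** The top flag cuts at [k, k + 2, ...] and the bottom flag at [k + 1, k + 3, ...]; a position is
    forbidden when some cut separates it in the wrong direction. *)
Lemma sw_rel_cut k n p q : (k.+1 < n)%N -> (p < n)%N -> (q < n)%N ->
  ~~ sw_rel k p q <->
  exists2 s, (0 < s < n)%N &
    ((k <= s)%N && ~~ odd (s - k) && (q < s <= p)%N) ||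
    ((k < s)%N && odd (s - k) && (p < s <= q)%N).
Proof.
move=> kn pn qn; split; last first.
  case=> s sn /orP[]/andP[/andP[ks os] ps]; rewrite /sw_rel /path_rel;
    by case: ltnP => pk; lia.
rewrite /sw_rel /path_rel; case: (ltnP p k) => pk /= H.
  by exists k.+1; lia.
have [qk|kq] := ltnP q k; first by exists k; lia.
rewrite kq /= in H; have [pq|qp|pq] := ltngtP p q.
(* A bottom cut is needed with [p < s <= q]. If [q] has the wrong parity, [q.-1] still exceeds [p],
   for otherwise the position would be an allowed edge. *)
- have [oq|eq] := boolP (odd (q - k)); first by exists q; lia.
  by exists q.-1; lia.
- have [op|ep] := boolP (odd (p - k)); last by exists p; lia.
  by exists p.-1; lia.
by rewrite pq eqxx in H.
Qed.

(** Only the partial sums strictly between 0 and [n] matter: the cuts 0 and [n] impose no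
    vanishing. *)
Lemma mem_seaweed_sw_rel (K : fieldType) k n (a b : seq nat) (x : 'M[K]_n) :
  (k.+1 < n)%N ->
  (forall s, (0 < s < n)%N ->
    reflect (exists2 i, (i <= size a)%N & sumn (take i a) = s)
      ((k <= s)%N && ~~ odd (s - k))) ->
  (forall s, (0 < s < n)%N ->
    reflect (exists2 i, (i <= size b)%N & sumn (take i b) = s)
      ((k < s)%N && odd (s - k))) ->
  x \in seaweed K n a b <->
  \tr x = 0 /\ supported (fun p q : 'I_n => sw_rel k p q) x.
Proof.
move=> kn cutA cutB; split=> [/mem_seaweed_entries[tr0 xa xb] | [tr0 Sx]].
  split=> // p q /(sw_rel_cut kn (ltn_ord p) (ltn_ord q))[s sn].
  case/orP=> /andP[].
    by case/cutA => // i ia si pq; apply: (xa i); rewrite ?si.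
  by case/cutB => // i ib si pq; apply: (xb i); rewrite ?si.
apply/mem_seaweed_entries; split=> // i p q ia pq; apply: Sx.
  apply/(sw_rel_cut kn (ltn_ord p) (ltn_ord q)); exists (sumn (take i a)).
    by have := ltn_ord p; lia.
  rewrite pq andbT; apply/orP; left; apply/cutA; last by exists i.
  by have := ltn_ord p; lia.
apply/(sw_rel_cut kn (ltn_ord p) (ltn_ord q)); exists (sumn (take i b)).
  by have := ltn_ord q; lia.
rewrite pq !andbT; apply/orP; right; apply/cutB; last by exists i.
by have := ltn_ord q; lia.
Qed.

Lemma sumn_take_nseq2 r i : sumn (take i (nseq r 2%N)) = (2 * minn i r)%N.
Proof. by elim: r i => [|r IH] [|i] //=; rewrite IH; lia. Qed.

Lemma sumn_take_nseq2_rcons1 r i :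
  sumn (take i (nseq r 2%N ++ [:: 1%N])) = (2 * minn i r + (r < i))%N.
Proof. by elim: r i => [|r IH] [|i] //=; rewrite IH; lia. Qed.

Lemma cut_nseq2 k r n s : (0 < s < n)%N -> (n <= k + 2 * r.+1)%N ->
  reflect (exists2 i, (i <= size (k :: nseq r 2%N))%N
                    & sumn (take i (k :: nseq r 2%N)) = s)
          ((k <= s)%N && ~~ odd (s - k)).
Proof.
move=> sn nk; apply: (iffP idP) => [H|[[|i] /= ir] si]; try lia.
  exists (s - k)./2.+1.
    by rewrite /= ?size_nseq; lia.
  by rewrite /= sumn_take_nseq2; lia.
by move: si; rewrite sumn_take_nseq2; lia.
Qed.

(** The final part 1 only adds the partial sum [n], which [s < n] excludes. *)
Lemma cut_nseq2_rcons1 k r n s : (0 < s < n)%N -> n = (k + 2 * r + 1)%N ->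
  reflect (exists2 i, (i <= size (k :: nseq r 2%N ++ [:: 1%N]))%N
                    & sumn (take i (k :: nseq r 2%N ++ [:: 1%N])) = s)
          ((k <= s)%N && ~~ odd (s - k)).
Proof.
move=> sn nk; apply: (iffP idP) => [H|[[|i] /= ir] si]; try lia.
  exists (s - k)./2.+1; 
    by rewrite /= ?size_cat ?size_nseq ?sumn_take_nseq2_rcons1 /=; lia.
by move: si; rewrite sumn_take_nseq2_rcons1; lia.
Qed.

Lemma supported_block_elt (K : fieldType) k m (x : 'M[K]_(k + m.+1)) :
  supported (fun p q : 'I_(k + m.+1) => sw_rel k p q) x <->
  exists X u T, path_mx T /\ x = block_elt X u T.
Proof.
split=> [Sx | [X [u [T [pT ->]]]] p q].
  exists (ulsubmx x), (col 0 (ursubmx x)), (drsubmx x); split=> [i j nij|].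
    by rewrite !mxE Sx // /sw_rel /= ltnNge leq_addr /= !addKn leq_addr.
  rewrite /block_elt -[x in LHS]submxK; congr block_mx.
    apply/matrixP => i j; rewrite [RHS]mxE big_ord1 !mxE eqxx /=.
    have [->|j0] := eqVneq j 0; first by rewrite mulr1.
    rewrite mulr0 Sx // /sw_rel /= ltn_ord -ltnNge -{1}[k]addn0 ltn_add2l.
    by rewrite lt0n -val_eqE in j0 *.
  apply/matrixP => i j; rewrite !mxE Sx // /sw_rel /= ltnNge leq_addr /=.
  by rewrite leqNgt ltn_ord.
rewrite /block_elt; case: (split_ordP p) => i ->; case: (split_ordP q) => j ->.
- by rewrite /sw_rel /= ltn_ord ltnW.
- rewrite /sw_rel /= ltn_ord -ltnNge -{1}[k]addn0 ltn_add2l => j0.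
  rewrite block_mxEur mxE big_ord1 !mxE -[j == 0]val_eqE /= gtn_eqF //.
  by rewrite ?andbF mulr0.
- by rewrite block_mxEdl mxE.
by rewrite /sw_rel /= ltnNge leq_addr /= !addKn leq_addr /= block_mxEdr => /pT.
Qed.

(** * The Frobenius property, the spectrum and the two families *)

Section Assembly.
Variables (K : numClosedFieldType) (k m : nat) (a b : seq nat).
Local Notation n := (k.+1 + m.+1)%N.
Local Notation S := (fun p q : 'I_n => sw_rel k.+1 p q).
Local Notation L := (subvs_of (seaweed K n a b)).
Local Notation br := (@seaweed_bracket K n a b).
Hypothesis memS : forall x, x \in seaweed K n a b <-> \tr x = 0 /\ supported S x.

Let n_gt0 : (0 < n)%N. Proof. by rewrite addSn. Qed.
Let S_refl : reflexive S. Proof. by move=> p; apply: sw_rel_refl. Qed.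
Let S_trans : transitive S. Proof. by move=> p q r; apply: sw_rel_trans. Qed.

Let supported_elt X u T : path_mx T -> supported S (block_elt X u T : 'M[K]_n).
Proof. by move=> pT; apply/supported_block_elt; exists X, u, T. Qed.

Let val_elt (x : L) : exists X u T, path_mx T /\ vsval x = block_elt X u T.
Proof. by apply/supported_block_elt; have /memS[] := subvsP x. Qed.

(** A solution for [mu = 0] becomes traceless after subtracting a scalar, which changes no bracket;
    it then lies in the radical and vanishes. *)
Lemma nondegenerate_functional_generic (F : 'Hom(L, K^o)) f :
  (forall y : L, F y = \tr (f *m vsval y)) ->
  nondegenerate_functional br F -> generic_functional f.
Proof.
move=> FE nd; apply: nondegenerate_generic_functional => X u T pT Hx.
have Se := supported_elt X u pT.
exists (\tr (block_elt X u T) / n%:R); apply/eqP; rewrite -subr_eq0; apply/eqP.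
have Le := supported_traceless n_gt0 S_refl memS Se.
suff x0 : Subvs Le = 0 by have := congr1 vsval x0; rewrite linear0.
apply: nd => y; rewrite FE /=; have [Y [w [T' [pT' ->]]]] := val_elt y.
have := Hx Y w T' pT'; rewrite mul0r => <-; congr (\tr (_ *m _)).
by rewrite mulmxBr mulmxBl scalar_mxC opprB addrA subrK.
Qed.

(** The upper left block is the nilpotent shift and the column part is the first unit row, so the
    Krylov matrix is the identity; the block of ones is nonzero on every edge. *)
Definition generic_functional_mx : 'M[K]_n :=
  block_mx (\matrix_(i, j) (j == i.+1 :> nat)%:R) 0 (delta_mx 0 0) (const_mx 1).

Lemma generic_functional_mxP : generic_functional generic_functional_mx.
Proof.
split=> [|o e _ _]; last first.
  by rewrite /generic_functional_mx block_mxKdr mxE oner_neq0.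
rewrite /functional_gl /functional_col /generic_functional_mx.
rewrite block_mxKul block_mxKdl; set A := \matrix_(i, j) _.
have -> : row 0 (delta_mx 0 0 : 'M[K]_(m.+1, k.+1)) = delta_mx 0 0.
  by apply/rowP => j; rewrite !mxE.
suff -> : krylov_mx A (delta_mx 0 0) = 1%:M by apply: unitmx1.
have step i (ik : (i < k.+1)%N) :
    delta_mx 0 0 *m A ^+ i = delta_mx 0 (Ordinal ik) :> 'rV_k.+1.
  elim: i ik => [|i IH] ik.
    by rewrite expr0 mulmx1; congr delta_mx; apply: val_inj.
  rewrite exprSr -mulmxE mulmxA (IH (ltnW ik)); apply/rowP => j.
  by rewrite delta_mulmxE !mxE eqxx mul1r -val_eqE.
apply/row_matrixP => i; rewrite rowK row1 (step i (ltn_ord i)).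
by congr delta_mx; apply: val_inj.
Qed.

Lemma seaweed_frobenius : frobenius br.
Proof.
pose hf (y : L) : K^o := \tr (generic_functional_mx *m vsval y).
have hf_lin : linear hf.
  move=> c y z; rewrite /hf.
  have -> : vsval (c *: y + z) = c *: vsval y + vsval z by exact: linearP.
  by rewrite mulmxDr -scalemxAr linearP.
pose h : {linear L -> K^o} := HB.pack hf (GRing.isLinear.Build _ _ _ _ hf hf_lin).
exists (linfun h) => x Hx; have [X [u [T [pT xE]]]] := val_elt x.
have xc : vsval x = (T 0 0)%:M.
  rewrite xE; apply: generic_functional_nondegenerate generic_functional_mxP pT _.
  move=> Y w T' pT'; rewrite mul0r -xE.
  have Le := supported_traceless n_gt0 S_refl memS (supported_elt Y w pT').
  rewrite -(Hx (Subvs Le)) lfunE /= /hf; congr (\tr (_ *m _)).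
  by rewrite /= mulmxBr mulmxBl scalar_mxC opprB addrA subrK.
apply: val_inj; rewrite linear0; apply: (etrans xc).
have /memS[] := subvsP x; rewrite xc mxtrace_scalar => /eqP.
by rewrite -mulr_natr mulf_eq0 pnatr_eq0 orbF => /eqP-> _; rewrite raddf0.
Qed.

Lemma ad_principal_char_poly (l : 'I_n) (F : 'Hom(L, K^o)) (Fh : L) :
  nondegenerate_functional br F -> principal_element br F Fh ->
  exists c, char_poly (mxof (vbasis {:L}) (vbasis {:L}) (ad br Fh)) =
    \prod_(z : 'I_n * 'I_n | sw_rel k.+1 z.1 z.2 && (z != (l, l)))
       ('X - (principal_weights k m c 0 z.1 - principal_weights k m c 0 z.2)%:P).
Proof.
move=> nd pF; have [f [FE fF]] := functional_matrix n_gt0 S_refl memS F.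
have gen := nondegenerate_functional_generic FE nd.
have [X [u [T [pT xE]]]] := val_elt Fh.
have Hx : coadjoint_scaled f (block_elt X u T) 1.
  move=> Y w T' pT'; have [y' [Fy' Fxy']] := fF _ (supported_elt Y w pT').
  by rewrite mul1r -Fy' -xE -Fxy' pF.
have [Z [s [Q [Z' [s' [Q' [pQ pQ' QQ' Qx]]]]]]] := principal_diag gen pT Hx.
exists (T 0 0).
apply: (char_poly_ad S_refl memS S_trans l (supported_elt Z s pQ)
          (supported_elt Z' s' pQ') QQ').
by rewrite xE.
Qed.

Lemma prod_principal_weights (l : 'I_n) c :
  \prod_(z : 'I_n * 'I_n | sw_rel k.+1 z.1 z.2 && (z != (l, l)))
       ('X - (principal_weights k m c 0 z.1 - principal_weights k m c 0 z.2)%:P)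
  = \prod_(z <- seaweed_spectrum K (k.+1 + m) k.+1) ('X - z%:P).
Proof.
pose g (z : int) : {poly K} := 'X - (z%:~R)%:P.
have g0 : g 0 = 'X by rewrite /g subr0.
pose w := principal_weights k m c.
pose G (p q : 'I_n) : {poly K} := 'X - (w 0 p - w 0 q)%:P.
have Gg p q i : w 0 p - w 0 q = i%:~R -> G p q = g i by rewrite /G /g => ->.
have wl i : w 0 (lshift _ i) = c + 1 + i%:R by rewrite /w row_mxEl mxE.
have wr j : w 0 (rshift _ j) = c + (odd j)%:R by rewrite /w row_mxEr mxE.
have Gll i j : G (lshift _ i) (lshift _ j) = g (i%:Z - j%:Z).
  by apply: Gg; rewrite !wl rmorphB /=; ring.
have Glr i : G (lshift _ i) (rshift _ ord0) = g i.+1.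
  by apply: Gg; rewrite wl wr -[RHS]/(i.+1%:R) -natr1 /=; ring.
have Grr i j : G (rshift _ i) (rshift _ j) = g ((odd i)%:Z - (odd j)%:Z).
  by apply: Gg; rewrite !wr rmorphB /=; ring.
have nX : ('X : {poly K}) != 0 by rewrite polyX_eq0.
(* The extra factor ['X] restores the missing position [(l, l)], whose weight difference is 0. *)
apply: (mulfI nX).
transitivity (\prod_(z : 'I_n * 'I_n | sw_rel k.+1 z.1 z.2) G z.1 z.2).
  rewrite [RHS](bigD1 (l, l)) ?sw_rel_refl //=; congr (_ * _).
  by rewrite /G subrr subr0.
rewrite -(pair_big_dep xpredT (fun p q : 'I_n => sw_rel k.+1 p q)) /=.
rewrite big_split_ord /=.
rewrite (_ : \prod_(i < k.+1) _ =
  (\prod_(i < k.+1) \prod_(j < k.+1) g (i%:Z - j%:Z)) * \prod_(i < k.+1) g i.+1);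
  last first.
  rewrite -big_split; apply: eq_bigr => i _; rewrite big_split_ord /=.
  congr (_ * _).
    by apply: eq_big => [j|j _]; [rewrite /sw_rel ltn_ord ltnW | exact: Gll].
  rewrite (big_pred1 ord0) ?Glr // => j.
  by rewrite /sw_rel /= ltn_ord -{2}[k.+1]addn0 leq_add2l leqn0.
rewrite (_ : \prod_(i < m.+1) _ =
  \prod_(i < m.+1) \prod_(j < m.+1 | path_rel i j) g ((odd i)%:Z - (odd j)%:Z));
  last first.
  apply: eq_bigr => i _; rewrite big_split_ord /= big_pred0 ?mul1r => [|j].
    apply: eq_big => [j|j _]; last exact: Grr.
    by rewrite /sw_rel ltnNge leq_addr /= leq_addr !addKn.
  by rewrite /sw_rel ltnNge leq_addr /= leqNgt ltn_ord.
(* The full block and column give [k.+1] zeros and [k.+1] ones, the path [m.+1] zeros and [m] ones;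
   one zero is absorbed by the extra ['X]. *)
rewrite prod_affine prod_path_rel prod_seaweed_spectrum /= -/(g 0) -/(g 1).
rewrite !g0 !exprD !exprS; ring.
Qed.

Lemma seaweed_spectrum_principal :
  spectrum br (seaweed_spectrum K (k.+1 + m) k.+1).
Proof.
split; first exact: seaweed_frobenius.
move=> F nd.
have [Fh FhP] := principal_element_unique (@seaweed_bracket_linearr K n a b)
  (@seaweed_bracket_linearl K n a b) nd.
exists Fh => //; have [c] := ad_principal_char_poly (rshift k.+1 ord_max) nd FhP.1.
by rewrite prod_principal_weights.
Qed.

Lemma seaweed_unimodal_spectrum : unimodal_spectrum br.
Proof.
have kN : (k < k.+1 + m)%N by rewrite addSn ltnS leq_addr.
have [s [sE sreal sunim]] := unimodal_multiplicities_seaweed K kN.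
exists s; split=> //; have [fr H] := seaweed_spectrum_principal.
by split=> // F /H[Fh uFh FhE]; exists Fh; rewrite // /eigenvalue_multiset sE.
Qed.

End Assembly.

Theorem mainTheorem8 (R : realType) (k r : nat)
    (hk : (1 <= k)%N) (hr : (1 <= r)%N) :
  (let g := @seaweed_bracket R[i] (k + 2 * r)%N
              (k :: nseq r 2%N) (k.+1 :: nseq (r - 1) 2%N ++ [:: 1%N]) in
   unimodal_spectrum g /\
   spectrum g
     (nseq (k + 2 * r - 1) 0 ++ nseq (k + 2 * r - 1) 1 ++
      flatten [seq nseq i (- k%:R + i%:R) ++ nseq i (k%:R - i%:R + 1)
              | i <- index_iota 1 k]))
  /\
  (let g := @seaweed_bracket R[i] (k + 2 * r + 1)%N
              (k :: nseq r 2%N ++ [:: 1%N]) (k.+1 :: nseq r 2%N) in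
   unimodal_spectrum g /\
   spectrum g
     (nseq (k + 2 * r) 0 ++ nseq (k + 2 * r) 1 ++
      flatten [seq nseq i (- k%:R + i%:R) ++ nseq i (k%:R - i%:R + 1)
              | i <- index_iota 1 k])).
Proof.
(* An odd offset from [k] is an even offset from [k.+1], so the same cut lemmas serve both
   compositions. *)
have evenP l s : (l < s)%N && odd (s - l) = (l.+1 <= s)%N && ~~ odd (s - l.+1) by lia.
case: k hk => // k _; case: r hr => // r _; split; cbv zeta.
- have -> : (k.+1 + 2 * r.+1 - 1 = k.+1 + (2 * r).+1)%N by lia.
  have -> : (k.+1 + 2 * r.+1 = k.+1 + (2 * r).+2)%N by lia.
  rewrite subSS subn0 -/(seaweed_spectrum _ _ _).
  split; [apply: seaweed_unimodal_spectrum | apply: seaweed_spectrum_principal] => x;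
    apply: mem_seaweed_sw_rel => [|s sn|s sn]; try lia; rewrite ?evenP;
    by [apply: (cut_nseq2 sn); lia | apply: (cut_nseq2_rcons1 sn); lia].
- have -> : (k.+1 + 2 * r.+1 + 1 = k.+1 + (2 * r.+1).+1)%N by lia.
  rewrite -/(seaweed_spectrum _ _ _).
  split; [apply: seaweed_unimodal_spectrum | apply: seaweed_spectrum_principal] => x;
    apply: mem_seaweed_sw_rel => [|s sn|s sn]; try lia; rewrite ?evenP;
    by [apply: (cut_nseq2_rcons1 sn); lia | apply: (cut_nseq2 sn); lia].
Qed.
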